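(* For any (dendroidal) inner Kan complex $X$, the natural map $\tau_d(X)\to Ho(X)$ is an isomorphism of operads.
   Context: Operad means symmetric coloured operad in sets. Trees are finite rooted trees with a root (output) edge and a set of leaves (input edges); vertices may have any number $\ge 0$ of inputs. $\eta$ is the tree with one edge and no vertices. An edge is inner if it has a vertex at both ends; otherwise it is outer. Each tree $T$ defines an operad $\Omega(T)$ whose colours are the edges of $T$ and which is freely generated by the vertices of $T$. The category $\Omega$ has trees as objects and operad maps $\Omega(T)\to\Omega(T')$ as arrows (such a map is determined by its effect on edges). A dendroidal set is a functor $X:\Omega^{op}\to Set$, with $X_T=X(T)$; $dSet$ is the category of dendroidal sets and $\Omega[T]$ the representable one. Faces of $T$: for an inner edge $e$, the inner face $\partial_e:T/e\to T$ obtained by contracting $e$; for a vertex $v$ with exactly one inner edge attached, the outer face $\partial_v:T/v\to T$ obtained by deleting $v$ and all outer edges attached to it; if $T$ has exactly one vertex, each edge of $T$ gives an outer face $\eta\to T$. For an inner edge $e$, the inner horn $\Lambda^e[T]\subseteq\Omega[T]$ is the union of all faces except $\partial_e$. A dendroidal set $K$ is an inner Kan complex if for every tree $T$ and inner edge $e$ of $T$ the map $Hom(\Omega[T],K)\to Hom(\Lambda^e[T],K)$ is surjective. The dendroidal nerve functor is $N_d(\mathcal P)_T=Hom(\Omega(T),\mathcal P)$, and $\tau_d:dSet\to Operad$ is its left adjoint. $C_n$ ($n\ge0$) is the corolla: one vertex, inputs $1,\dots,n$, output $0$; for $0\le i\le n$, $i:\eta\to C_n$ is the map with image the edge $i$.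 Homotopy: let $f,g\in X_{C_n}$. For $1\le i\le n$ write $f\sim_i g$ if there is a dendrex $H$ of $X$ whose shape is the tree with a vertex having inputs $1,\dots,n$ and output $0$ and a unary vertex with input $i'$ and output $i$, such that: the face with inputs $1,\dots,n$ and output $0$ (deleting the unary vertex) of $H$ is $f$; the inner face contracting $i$ (inputs $1,\dots,i',\dots,n$, output $0$) is $g$; and the face consisting of the unary vertex is degenerate, i.e. in the image of $X_\eta\to X_{C_1}$ induced by $C_1\to\eta$. Write $f\sim_0 g$ if there is a dendrex $H$ whose shape is the tree with a vertex with inputs $1,\dots,n$ and output $0$ and a unary vertex with input $0$ and output $0'$, such that the face with inputs $1,\dots,n$ and output $0$ is $f$, the inner face contracting $0$ (inputs $1,\dots,n$, output $0'$) is $g$, and the face consisting of the unary vertex is degenerate. For an inner Kan complex $X$ the relations $\sim_0,\dots,\sim_n$ on $X_{C_n}$ are equivalence relations and all coincide; they are written $\sim$. For $x_1,\dots,x_n,x\in X_\eta$ let $X(x_1,\dots,x_n;x)\subseteq X_{C_n}$ be the set of $f$ with $0^*(f)=x$ and $i^*(f)=x_i$ for $1\le i\le n$, and let $Ho(X)(x_1,\dots,x_n;x)=X(x_1,\dots,x_n;x)/\sim$. The collection $Ho(X)$ with colours $X_\eta$ carries a unique operad structure for which there is a map of dendroidal sets $q:X\to N_d(Ho(X))$ that is the identity on $\eta$-shaped dendrices and sends $f\in X_{C_n}$ to its class $[f]$: composition is $[f]\circ_i[g]=[h]$ whenever there is a dendrex of shape $C_n\circ_iC_m$ (the corolla $C_m$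 grafted on the leaf $i$ of $C_n$) whose two outer faces are $f$ and $g$ and whose inner face is $h$; symmetric groups act through the automorphisms of $C_n$. The natural map $\tau_d(X)\to Ho(X)$ is the operad map adjoint to $q$. *)

(* Defs.v *)
From HB Require Import structures.
From mathcomp Require Import all_boot.
From mathcomp Require Import boolp.

Set Implicit Arguments.
Unset Strict Implicit.
Unset Printing Implicit Defensive.

(* Operads are written with inputs labelled by an arbitrary finite set [I]:
   [op c d] is P(c_1,...,c_n;d) with [c : I -> colour], and the case [I = 'I_n]
   is the usual one. [act] is the relabelling along a bijection (the symmetric
   group action when source and target agree); the colouring of its result is
   only required to be pointwise equal to [c \o s]. [comp] at the input [i] is the
   partial composition o_i, whose inputs are those of the first operation other
   than [i] together with those of the second. The proofs of bijectivity and of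
   equality of colourings in the axioms are quantified, but all of them exist
   and are irrelevant. *)
Definition splice (I J : finType) (i : I) : finType := ({x : I | x != i} + J)%type.

Definition splice_col (C : Type) (I J : finType) (i : I) (c : I -> C) (b : J -> C)
    (z : splice J i) : C :=
  match z with inl x => c (val x) | inr y => b y end.

Lemma inj_neq (I J : finType) (s : J -> I) (j x : J) :
  injective s -> x != j -> s x != s j.
Proof. by move=> s_inj; rewrite inj_eq. Qed.

Definition splice_unit (I : finType) (i x : I) : splice unit i :=
  if insub x is Some y then inl y else inr tt.

Definition splice_map (I J I' J' : finType) (s : I' -> I) (t : J' -> J)
    (s_inj : injective s) (i : I') (z : splice J' i) : splice J (s i) :=
  match z with
  | inl (exist x xi) => inl (exist _ (s x) (inj_neq s_inj xi))
  | inr y => inr (t y)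
  end.

Definition splice_seq (I J K : finType) (i : I) (j : J)
    (z : splice (splice K j) i) : splice K (inr j : splice J i) :=
  match z with
  | inl x => inl (exist _ (inl x) isT)
  | inr (inl (exist y yj)) => inl (exist _ (inr y) yj)
  | inr (inr k) => inr k
  end.

Definition splice_swap (I : finType) (i : I) (k : {x : I | x != i}) :
  {x : I | x != val k} := exist _ i (introN eqP (fun e => elimN eqP (valP k) (esym e))).

Definition splice_par (I J K : finType) (i : I) (k : {x : I | x != i})
    (z : splice K (inl k : splice J i)) :
    splice J (inl (splice_swap k) : splice K (val k)) :=
  match z with
  | inl (exist (inl (exist x xi)) xk) => inl (exist _ (inl (exist _ x xk)) xi)
  | inl (exist (inr y) _) => inr y
  | inr z' => inl (exist _ (inr z') isT)
  end.

Record operad_struct (C : Type)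
    (op : forall I : finType, (I -> C) -> C -> Type) := OperadStruct {
  unit_op : forall c : C, op unit (fun=> c) c;
  act : forall (I J : finType) (c : I -> C) (c' : J -> C) (d : C) (s : J -> I),
    bijective s -> c' =1 c \o s -> op I c d -> op J c' d;
  comp : forall (I J : finType) (c : I -> C) (b : J -> C) (d e : C) (i : I),
    e = c i -> op I c d -> op J b e -> op (splice J i) (splice_col c b) d;

  act_id : forall (I : finType) (c : I -> C) (d : C) (f : op I c d)
    (bij : bijective id) (ec : c =1 c \o id), act bij ec f = f;
  act_act : forall (I J K : finType) (c : I -> C) (c' : J -> C) (c'' : K -> C) (d : C)
    (s : J -> I) (t : K -> J) (f : op I c d)
    (s_bij : bijective s) (t_bij : bijective t) (st_bij : bijective (s \o t))
    (ec : c' =1 c \o s) (ec' : c'' =1 c' \o t) (ec'' : c'' =1 c \o (s \o t)),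
    act t_bij ec' (act s_bij ec f) = act st_bij ec'' f;
  comp_act : forall (I J I' J' : finType) (c : I -> C) (b : J -> C)
    (c' : I' -> C) (b' : J' -> C) (d e : C) (s : I' -> I) (t : J' -> J) (i : I')
    (f : op I c d) (g : op J b e)
    (s_bij : bijective s) (t_bij : bijective t)
    (ec : c' =1 c \o s) (eb : b' =1 b \o t) (ei' : e = c' i) (ei : e = c (s i))
    (st_bij : bijective (splice_map t (bij_inj s_bij) (i := i)))
    (ecb : splice_col c' b' =1 splice_col c b \o splice_map t (bij_inj s_bij) (i := i)),
    comp ei' (act s_bij ec f) (act t_bij eb g) = act st_bij ecb (comp ei f g);
  comp_unitl : forall (J : finType) (b : J -> C) (d : C) (f : op J b d)
    (bij : bijective (inr : J -> splice J tt))
    (eb : b =1 splice_col (fun=> d) b \o inr),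
    act bij eb (comp (i := tt) erefl (unit_op d) f) = f;
  comp_unitr : forall (I : finType) (c : I -> C) (d : C) (i : I) (f : op I c d)
    (bij : bijective (splice_unit i))
    (ec : c =1 splice_col c (fun=> c i) \o splice_unit i),
    act bij ec (comp erefl f (unit_op (c i))) = f;
  comp_seq : forall (I J K : finType) (c : I -> C) (b : J -> C) (a : K -> C) (d e e' : C)
    (i : I) (j : J) (f : op I c d) (g : op J b e) (h : op K a e')
    (ei : e = c i) (ej : e' = b j)
    (bij : bijective (@splice_seq I J K i j))
    (ec : splice_col c (splice_col b a)
            =1 splice_col (splice_col c b) a \o @splice_seq I J K i j),
    act bij ec (comp (i := inr j) ej (comp ei f g) h) = comp ei f (comp ej g h);
  comp_par : forall (I J K : finType) (c : I -> C) (b : J -> C) (a : K -> C) (d e e' : C)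
    (i : I) (k : {x : I | x != i}) (f : op I c d) (g : op J b e) (h : op K a e')
    (ei : e = c i) (ek : e' = c (val k))
    (bij : bijective (@splice_par I J K i k))
    (ec : splice_col (splice_col c b) a
            =1 splice_col (splice_col c a) b \o @splice_par I J K i k),
    act bij ec (comp (i := inl (splice_swap k)) ei (comp ek f h) g)
      = comp (i := inl k) ek (comp ei f g) h
}.

Record operad := Operad {
  colour : Type;
  op : forall I : finType, (I -> colour) -> colour -> Type;
  operad_ops :> operad_struct op
}.

Record operad_map (P Q : operad) := OperadMap {
  cmap : colour P -> colour Q;
  omap : forall (I : finType) (c : I -> colour P) (d : colour P),
    op c d -> op (cmap \o c) (cmap d);
  omap_unit : forall c : colour P, omap (unit_op P c) = unit_op Q (cmap c);
  omap_act : forall (I J : finType) (c : I -> colour P) (c' : J -> colour P)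
    (d : colour P) (s : J -> I) (s_bij : bijective s) (ec : c' =1 c \o s)
    (ec' : cmap \o c' =1 (cmap \o c) \o s) (f : op c d),
    omap (act P s_bij ec f) = act Q s_bij ec' (omap f);
  omap_comp : forall (I J : finType) (c : I -> colour P) (b : J -> colour P)
    (d e : colour P) (i : I) (ei : e = c i) (ei' : cmap e = cmap (c i))
    (id_bij : bijective id)
    (ec : cmap \o splice_col c b =1
            splice_col (i := i) (cmap \o c) (cmap \o b) \o id)
    (f : op c d) (g : op b e),
    omap (comp P ei f g) = act Q id_bij ec (comp Q ei' (omap f) (omap g))
}.

Arguments omap_act {P Q} o {I J c c' d s} s_bij ec ec' f.
Arguments omap_comp {P Q} o {I J c b d e i} ei ei' id_bij ec f g.
Arguments act_act {C op} o {I J K c c' c'' d s t} f s_bij t_bij st_bij ec ec' ec''.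

Local Obligation Tactic := idtac.

Program Definition operad_id (P : operad) : operad_map P P :=
  @OperadMap P P id (fun I c d f => f) _ _ _.
Next Obligation. by []. Qed.
Next Obligation.
by move=> P I J c c' d s s_bij ec ec' f; congr act; apply: Prop_irrelevance.
Qed.
Next Obligation.
move=> P I J c b d e i ei ei' id_bij ec f g.
rewrite (_ : ei' = ei) ?act_id //; exact: Prop_irrelevance.
Qed.

Program Definition operad_comp (P Q R : operad) (G : operad_map Q R) (F : operad_map P Q) :
    operad_map P R :=
  @OperadMap P R (cmap G \o cmap F) (fun I c d f => omap G (omap F f)) _ _ _.
Next Obligation. by move=> P Q R G F c; exact: etrans (congr1 _ (omap_unit F c)) (omap_unit G _). Qed.
Next Obligation.
move=> P Q R G F I J c c' d s s_bij ec ec' f.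
have ec1 : cmap F \o c' =1 (cmap F \o c) \o s by move=> x /=; rewrite ec.
by rewrite (omap_act F _ _ ec1) (omap_act G _ _ ec').
Qed.
Next Obligation.
move=> P Q R G F I J c b d e i ei ei' id_bij ec f g.
have ei1 : cmap F e = cmap F (c i) by rewrite ei.
have ec1 : cmap F \o splice_col c b =1
            splice_col (i := i) (cmap F \o c) (cmap F \o b) \o id by case.
have ec2 : cmap G \o splice_col (i := i) (cmap F \o c) (cmap F \o b) =1
   splice_col (i := i) (cmap G \o (cmap F \o c)) (cmap G \o (cmap F \o b)) \o id by case.
have ec3 : cmap G \o (cmap F \o splice_col c b) =1
   (cmap G \o splice_col (i := i) (cmap F \o c) (cmap F \o b)) \o id by case.
rewrite (omap_comp F ei ei1 id_bij ec1) (omap_act G id_bij ec1 ec3).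
by rewrite (omap_comp G ei1 ei' id_bij ec2) (act_act _ _ _ _ id_bij _ _ ec).
Qed.

Lemma operad_map_eq (P Q : operad) (F G : operad_map P Q) :
  cmap F = cmap G ->
  (forall (I : finType) (c : I -> colour P) (d : colour P) (f : op c d)
     (e : cmap F = cmap G),
     eq_rect _ (fun h => op (h \o c) (h d)) (omap F f) _ e = omap G f) -> F = G.
Proof.
case: F G => [cF oF F1 F2 F3] [cG oG G1 G2 G3] /= e; case: _ / e oG G1 G2 G3.
move=> oG G1 G2 G3 /(_ _ _ _ _ erefl) /= oFG.
have e : oF = oG by do 3!(apply: functional_extensionality_dep => ?); apply: funext.
by case: _ / e G1 G2 G3 {oFG} => *; congr OperadMap; apply: Prop_irrelevance.
Qed.

Definition operad_iso (P Q : operad) (F : operad_map P Q) : Prop :=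
  exists G : operad_map Q P,
    operad_comp G F = operad_id P /\ operad_comp F G = operad_id Q.

Record tree := Tree {
  edge : finType;
  vertex : finType;
  root : edge;
  out : vertex -> edge;
  (* the vertex of which an edge is an input *)
  dest : edge -> option vertex;
  out_inj : injective out;
  destP : forall x : edge, (dest x == None) = (x == root);
  rooted : forall x : edge, exists n : nat,
    iter n (fun y => if dest y is Some v then out v else y) x = root
}.

Definition down (T : tree) (x : edge T) : edge T :=
  if dest x is Some v then out v else x.

Definition inputs (T : tree) (v : vertex T) : {set edge T} := [set x | dest x == Some v].

Definition inner (T : tree) (x : edge T) : bool := (x \in codom (@out T)) && (dest x != None).

(* [subtree e A]: there is a subtree of T with root edge [e] and set of leaves [A]. *)
Inductive subtree (T : tree) (e : edge T) : {set edge T} -> Prop :=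
| subtree_edge : subtree e [set e]
| subtree_graft (A : {set edge T}) (v : vertex T) :
    subtree e A -> out v \in A -> subtree e ((A :\ out v) :|: inputs v).

(* The operations of the operad of T. An operation of the free operad on the vertices
   is determined by its inputs and output, so the sets of operations can be taken in
   [Prop]; [omega_free] below proves that the result is indeed the free operad. *)
Definition tree_op (T : tree) (I : finType) (c : I -> edge T) (e : edge T) : Prop :=
  injective c /\ subtree e [set c i | i : I].

Section TreeOrder.
Variable T : tree.
Implicit Types (x y : edge T) (A : {set edge T}).

Definition above x y := exists n, iter n (@down T) x = y.

Lemma down_root : down (root T) = root T.
Proof. by rewrite /down; have /eqP -> : dest (root T) == None by rewrite destP. Qed.

Lemma down_out v x : x \in inputs v -> down x = out v.
Proof. by rewrite inE /down => /eqP ->. Qed.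

Lemma iter_root n : iter n (@down T) (root T) = root T.
Proof. by elim: n => //= n ->; exact: down_root. Qed.

Lemma above_root x : above x (root T).
Proof. by case: (rooted x) => n nP; exists n. Qed.

Lemma iter_cycle x n : iter n.+1 (@down T) x = x -> x = root T.
Proof.
move=> xx; have [m mx] := above_root x.
have : iter (m * n.+1) (@down T) x = x.
  elim: m {mx} => [//|m IH]; by rewrite mulSn iterD IH.
by rewrite mulnS addnC iterD mx iter_root.
Qed.

Lemma above_refl x : above x x. Proof. by exists 0. Qed.

Lemma above_trans x y z : above x y -> above y z -> above x z.
Proof. by move=> [n <-] [m <-]; exists (m + n); rewrite iterD. Qed.

Lemma above_anti x y : above x y -> above y x -> x = y.
Proof.
move=> [[|n] xy] [m yx] //; have: iter (m + n.+1) (@down T) x = x by rewrite iterD xy.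
rewrite addnS => /iter_cycle xr; by rewrite -xy xr iter_root.
Qed.

Lemma above_total x y z : above x y -> above x z -> above y z \/ above z y.
Proof.
move=> [n <-] [m <-]; case/orP: (leq_total n m) => nm.
  by left; exists (m - n); rewrite -iterD subnK.
by right; exists (n - m); rewrite -iterD subnK.
Qed.

Lemma above_down x : above x (down x). Proof. by exists 1. Qed.

Lemma above_input x v : x \in inputs v -> above x (out v).
Proof. by move/down_out <-; exact: above_down. Qed.

Lemma input_neq x v : x \in inputs v -> x != out v.
Proof.
move=> xv; apply/eqP => xo; have := @iter_cycle x 0; rewrite /= (down_out xv) -xo.
move=> /(_ erefl) xr; move: xv; rewrite inE xr.
by have /eqP -> : dest (root T) == None by rewrite destP.
Qed.

Lemma above_step x y : above x y -> x != y -> above (down x) y.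
Proof. by move=> [[|n] <-]; rewrite ?eqxx // => _; exists n; rewrite iterSr. Qed.

Lemma input_above v x y : x \in inputs v -> y \in inputs v -> above x y -> x = y.
Proof.
move=> xv yv xy; apply/eqP; apply/negPn/negP => /(above_step xy).
rewrite (down_out xv) => vy; have vy' := above_anti vy (above_input yv).
by move: (input_neq yv); rewrite vy' eqxx.
Qed.

Lemma subtree_above e A x : subtree e A -> x \in A -> above x e.
Proof.
move=> eA; elim: eA x => [x|{}A v eA IH vA x].
  by rewrite inE => /eqP ->; exact: above_refl.
rewrite in_setU in_setD1 => /orP[/andP[_ /IH//]|xv].
exact: above_trans (above_input xv) (IH _ vA).
Qed.

Lemma subtree_anti e A x y : subtree e A -> x \in A -> y \in A -> above x y -> x = y.
Proof.
move=> eA; elim: eA x y => [x y|{}A v eA IH vA x y].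
  by rewrite !inE => /eqP -> /eqP ->.
rewrite !in_setU !in_setD1 => /orP[/andP[xv xA]|xv] /orP[/andP[yv yA]|yv] xy.
- exact: IH.
- have xv' : x = out v by apply: IH => //; exact: above_trans xy (above_input yv).
  by rewrite xv' eqxx in xv.
- have [e1|ne] := eqVneq x y; first by [].
  have vy := above_step xy ne; rewrite (down_out xv) in vy.
  by move: yv; rewrite (IH _ _ vA yA vy) eqxx.
- exact: (input_above xv yv xy).
Qed.

Lemma subtree_disj e A B x y : subtree e A -> x \in A -> subtree x B ->
  y \in A -> y \in B -> y = x.
Proof. by move=> eA xA xB yA /(subtree_above xB) yx; exact: subtree_anti eA yA xA yx. Qed.

Lemma subtree_comp e A x B :
  subtree e A -> x \in A -> subtree x B -> subtree e ((A :\ x) :|: B).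
Proof.
move=> eA xA xB; elim: xB => [|{}B v xB IH vB]; first by rewrite setUC setD1K.
rewrite (_ : _ :|: _ = ((A :\ x :|: B) :\ out v) :|: inputs v).
  by apply: subtree_graft => //; rewrite in_setU vB orbT.
apply/setP => y; rewrite !inE; have [->|//] := eqVneq y (out v); last by rewrite !andTb orbA.
rewrite andFb orFb; have [//|vx] := eqVneq (out v) x.
rewrite andTb; case: (boolP (out v \in A)) => // vA.
by rewrite (subtree_disj eA xA xB vA vB) eqxx in vx.
Qed.

Lemma subtree_vertex (v : vertex T) : subtree (out v) (inputs v).
Proof.
have := subtree_graft (subtree_edge (out v)) (set11 (out v)).
by rewrite setDv set0U.
Qed.

End TreeOrder.

Lemma tree_op_unit (T : tree) (e : edge T) : tree_op (fun _ : unit => e) e.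
Proof.
split; first by case=> -[].
rewrite (_ : [set _ | _ in _] = [set e]); first exact: subtree_edge.
by apply/setP => x; rewrite inE; apply/imsetP/eqP => [[]|->] //; exists tt.
Qed.

Lemma tree_op_act (T : tree) (I J : finType) (c : I -> edge T) (c' : J -> edge T)
    (e : edge T) (s : J -> I) :
  bijective s -> c' =1 c \o s -> tree_op c e -> tree_op c' e.
Proof.
move=> [t st ts] ec [c_inj ce]; split.
  by move=> x y; rewrite !ec /= => /c_inj /(can_inj st).
rewrite (_ : [set c' i | i : J] = [set c i | i : I]) //.
apply/setP => x; apply/imsetP/imsetP => -[i _ ->].
  by exists (s i) => //; rewrite ec.
by exists (t i) => //; rewrite ec /= ts.
Qed.

Lemma tree_op_comp (T : tree) (I J : finType) (c : I -> edge T) (b : J -> edge T)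
    (d e : edge T) (i : I) :
  e = c i -> tree_op c d -> tree_op b e -> tree_op (splice_col (i := i) c b) d.
Proof.
move=> -> [c_inj cd] [b_inj be].
have cI x : c x \in [set c i | i : I] by exact: imset_f.
have bJ y : b y \in [set b j | j : J] by exact: imset_f.
split.
  have disj (x : {x : I | x != i}) y : c (val x) = b y -> False.
    move=> xy; have bI : b y \in [set c i | i : I] by rewrite -xy.
    have := subtree_disj cd (cI i) be bI (bJ y); rewrite -xy => /c_inj xi.
    by have := valP x; rewrite xi eqxx.
  move=> [x|y] [x'|y'] /=.
  - by move/c_inj/val_inj ->.
  - by move/disj.
  - by move/esym/disj.
  - by move/b_inj ->.
rewrite (_ : [set _ | _ in _] = ([set c i | i : I] :\ c i) :|: [set b j | j : J]).
  exact: subtree_comp.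
apply/setP => z; rewrite in_setU in_setD1; apply/imsetP/orP.
  case=> -[x|y] _ -> /=; [left | right]; last exact: bJ.
  by rewrite cI inj_eq // (valP x).
case=> [/andP[zi /imsetP[x _ zx]]|/imsetP[y _ ->]].
  have xi : x != i by apply: contra_neq zi => <-.
  by exists (inl (exist _ x xi)).
by exists (inr y).
Qed.

Program Definition omega_struct (T : tree) : operad_struct (@tree_op T) :=
  @OperadStruct (edge T) (@tree_op T) (@tree_op_unit T) (@tree_op_act T)
    (@tree_op_comp T) _ _ _ _ _ _ _.
Solve Obligations with by move=> *; apply: Prop_irrelevance.

Definition omega (T : tree) : operad := Operad (omega_struct T).

Lemma omega_thin (T : tree) (I : finType) (c : I -> colour (omega T)) (e : colour (omega T))
  (f g : op c e) : f = g.
Proof. exact: (@Prop_irrelevance (tree_op c e)). Qed.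

Lemma subtree_map (S T : tree) (f : edge S -> edge T) (e : edge S) (A : {set edge S}) :
  (forall v : vertex S, tree_op (fun x : {x | x \in inputs v} => f (val x)) (f (out v))) ->
  subtree e A -> {in A &, injective f} /\ subtree (f e) (f @: A).
Proof.
move=> fv; elim=> [|{}A v eA [f_inj fA] vA].
  by rewrite imset_set1; split; [move=> x y /set1P -> /set1P -> | exact: subtree_edge].
have [v_inj vf] := fv v.
have fE : f @: inputs v = [set f (val x) | x : {x | x \in inputs v}].
  apply/setP => y; apply/imsetP/imsetP => [[x xv ->]|[x _ ->]].
    by exists (exist _ x xv).
  by exists (val x) => //; exact: (valP x).
rewrite -fE in vf.
have fvA : f (out v) \in f @: A by exact: imset_f.
have disj x y : x \in A :\ out v -> y \in inputs v -> f x = f y -> False.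
  rewrite in_setD1 => /andP[xv xA] yv xy.
  have := subtree_disj fA fvA vf (imset_f f xA).
  by rewrite {1}xy => /(_ (imset_f f yv)) /(f_inj _ _ xA vA) => xv'; rewrite xv' eqxx in xv.
split.
  move=> x y /setUP[xA|xv] /setUP[yA|yv] xy.
  - by move: xA yA => /setD1P[_ xA] /setD1P[_ yA]; exact: f_inj.
  - by case: (disj x y).
  - by case: (disj y x).
  - by have [] := v_inj (exist _ x xv) (exist _ y yv) xy.
rewrite imsetU; have -> : f @: (A :\ out v) = (f @: A) :\ f (out v).
  apply/setP => y; rewrite in_setD1; apply/imsetP/andP => [[x /setD1P[xv xA] ->]|].
    by split; [apply: contra_neq xv => /f_inj -> | exact: imset_f].
  by case=> yv /imsetP[x xA yx]; exists x => //; rewrite in_setD1 xA andbT; apply: contra_neq yv => <-.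
exact: subtree_comp.
Qed.

Program Definition omega_map (S T : tree) (f : edge S -> edge T)
    (fv : forall v : vertex S,
      tree_op (fun x : {x | x \in inputs v} => f (val x)) (f (out v))) :
    operad_map (omega S) (omega T) :=
  @OperadMap (omega S) (omega T) f _ _ _ _.
Next Obligation.
move=> S T f fv I c e [c_inj ce]; have [f_inj fe] := subtree_map fv ce; split.
  by move=> x y /= /f_inj; rewrite !imset_f // => /(_ isT isT) /c_inj.
rewrite (_ : [set _ | _ in _] = f @: [set c i | i : I]) //.
by rewrite -imset_comp.
Qed.
Solve Obligations with by move=> *; exact: omega_thin.

Lemma omega_map_eq (S T : tree) (F G : operad_map (omega S) (omega T)) :
  cmap F =1 cmap G -> F = G.
Proof.
by move/funext => FG; apply: operad_map_eq => // *; exact: omega_thin.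
Qed.

Lemma act_eq (P : operad) (I J : finType) (c : I -> colour P) (c' : J -> colour P)
    (d : colour P) (s s' : J -> I) (p : op c d) (bij : bijective s) (bij' : bijective s')
    (ec : c' =1 c \o s) (ec' : c' =1 c \o s') :
  s =1 s' -> act P bij ec p = act P bij' ec' p.
Proof.
move/funext => e; case: _ / e bij' ec' => bij' ec'.
by congr act; apply: Prop_irrelevance.
Qed.

Lemma actK (P : operad) (I J : finType) (c : I -> colour P) (c' : J -> colour P)
    (d : colour P) (s : J -> I) (p : op c d) (q : op c' d)
    (bij : bijective s) (ec : c' =1 c \o s) :
  act P bij ec p = q ->
  exists (t : I -> J) (bij' : bijective t) (ec' : c =1 c' \o t),
    cancel s t /\ act P bij' ec' q = p.
Proof.
move=> <-; case: {+}bij => t st ts; have bij' : bijective t by exists s.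
have ec' : c =1 c' \o t by move=> x /=; rewrite ec /= ts.
have id_bij : bijective (@id I) by exists id.
exists t, bij', ec'; split => //.
rewrite (act_act _ _ _ _ (bij_comp bij bij') _ _ (fun x => etrans (ec' x) (ec (t x)))).
by rewrite -[RHS](act_id P p id_bij (fun=> erefl)); exact: act_eq.
Qed.

Lemma tree_op_vertex (T : tree) (v : vertex T) :
  tree_op (fun x : {x | x \in inputs v} => val x) (out v).
Proof.
split; first exact: val_inj.
rewrite (_ : [set _ | _ in _] = inputs v); first exact: subtree_vertex.
apply/setP => y; apply/imsetP/idP => [[x _ ->]|yv]; first exact: (valP x).
by exists (exist _ y yv).
Qed.

Lemma above_inputs (T : tree) (v : vertex T) (x : edge T) :
  above x (out v) -> x != out v -> exists2 y, y \in inputs v & above x y.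
Proof.
move=> [n]; elim: n x => [|n IH] x; first by move=> /= ->; rewrite eqxx.
rewrite iterSr => xn xv; have [dv|] := eqVneq (down x) (out v).
  exists x; last exact: above_refl.
  move: dv xv; rewrite inE /down; case: (dest x) => [w /out_inj ->|->] //.
  by rewrite eqxx.
by move=> /(IH _ xn)[y yv xy]; exists y => //; exact: above_trans (above_down x) xy.
Qed.

Lemma splice_map_bij (I J I' J' : finType) (s : I' -> I) (t : J' -> J) (i : I')
    (s_bij : bijective s) (t_bij : bijective t) (s_inj : injective s) :
  bijective (splice_map t s_inj (i := i)).
Proof.
case: s_bij => s' ss s's; case: t_bij => t' tt t't.
pose r (z : splice J (s i)) : splice J' i :=
  match z with
  | inl (exist x xi) => inl (exist (fun x => x != i) (s' x)
      (introN eqP (fun e => elimN eqP xi (etrans (esym (s's x)) (congr1 s e)))))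
  | inr y => inr (t' y)
  end.
exists r; first by case=> [[x xi]|y] /=; rewrite ?tt //; congr inl; apply: val_inj => /=; rewrite ss.
by case=> [[x xi]|y] /=; rewrite ?t't //; congr inl; apply: val_inj => /=; rewrite s's.
Qed.

Lemma splice_unit_bij (I : finType) (i : I) : bijective (splice_unit i).
Proof.
exists (fun z : splice unit i => if z is inl x then val x else i) => [x|[x|[]]] /=.
- by rewrite /splice_unit; case: insubP => [y _ <-//|/negPn/eqP].
- by rewrite /splice_unit valK.
- by rewrite /splice_unit insubF // eqxx.
Qed.

Lemma splice_unitl_bij (J : finType) : bijective (inr : J -> splice J tt).
Proof.
exists (fun z : splice J tt => match z with
  | inl (exist x xi) => match elimN eqP xi (match x with tt => erefl end) with end
  | inr y => y end) => [//|[[[] xi]|//]].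
by case: (elimN eqP xi _).
Qed.

Lemma splice_seq_bij (I J K : finType) (i : I) (j : J) : bijective (@splice_seq I J K i j).
Proof.
exists (fun z : splice K (inr j : splice J i) => match z with
  | inl (exist (inl x) _) => inl x
  | inl (exist (inr y) yj) => inr (inl (exist _ y yj))
  | inr k => inr (inr k)
  end : splice (splice K j) i).
  by case=> [x|[[y yj]|k]].
by case=> [[[x|y] yj]|k] //=; congr inl; apply: val_inj.
Qed.

Lemma splice_par_bij (I J K : finType) (i : I) (k : {x : I | x != i}) :
  bijective (@splice_par I J K i k).
Proof.
exists (fun z : splice J (inl (splice_swap k) : splice K (val k)) => match z with
  | inl (exist (inl (exist x xk)) xi) => inl (exist _ (inl (exist _ x xi)) xk)
  | inl (exist (inr y) _) => inr y
  | inr z' => inl (exist _ (inr z') isT)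
  end : splice K (inl k : splice J i)).
  case=> [[[[x xi]|y] xk]|z] //=; congr inl; apply: val_inj => //=.
by case=> [[[[x xi]|y] xk]|z] //=; congr inl; apply: val_inj.
Qed.

Lemma act_actE (P : operad) (I J K : finType) (c : I -> colour P) (c' : J -> colour P)
    (c'' : K -> colour P) (d : colour P) (s : J -> I) (t : K -> J) (p : op c d)
    (s_bij : bijective s) (t_bij : bijective t) (ec : c' =1 c \o s) (ec' : c'' =1 c' \o t) :
  act P t_bij ec' (act P s_bij ec p) =
    act P (bij_comp s_bij t_bij) (fun x => etrans (ec' x) (ec (t x))) p.
Proof. exact: act_act. Qed.

Lemma comp_actl (I J I' : finType) (s : I' -> I) (i : I') (j : I) :
  bijective s -> s i = j ->
  exists (r : splice J i -> splice J j) (r_bij : bijective r),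
    (forall (C : Type) (c : I -> C) (b : J -> C) (c' : I' -> C), c' =1 c \o s ->
       splice_col c' b =1 splice_col c b \o r) /\
    (forall (P : operad) (c : I -> colour P) (b : J -> colour P) (c' : I' -> colour P)
       (d e : colour P) (p : op c d) (q : op b e) (s_bij : bijective s)
       (ec : c' =1 c \o s) (ei' : e = c' i) (ei : e = c j)
       (ecr : splice_col c' b =1 splice_col c b \o r),
       comp P ei' (act P s_bij ec p) q = act P r_bij ecr (comp P ei p q)).
Proof.
move=> s_bij' sij; case: _ / sij.
have id_bij : bijective (@id J) by exists id.
exists (splice_map id (bij_inj s_bij') (i := i)), (splice_map_bij i s_bij' id_bij (bij_inj s_bij')).
split; first by move=> C c b c' ec [[x xi]|y] //=; rewrite ec.
move=> P c b c' d e p q s_bij ec ei' ei ecr.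
rewrite -{1}(act_id P q id_bij (fun=> erefl)).
by rewrite (Prop_irrelevance s_bij s_bij'); exact: comp_act.
Qed.

Lemma comp_actr (I J J' : finType) (t : J' -> J) (i : I) :
  bijective t ->
  exists (r : splice J' i -> splice J i) (r_bij : bijective r),
    (forall (C : Type) (c : I -> C) (b : J -> C) (b' : J' -> C), b' =1 b \o t ->
       splice_col c b' =1 splice_col c b \o r) /\
    (forall (P : operad) (c : I -> colour P) (b : J -> colour P) (b' : J' -> colour P)
       (d e : colour P) (p : op c d) (q : op b e) (t_bij : bijective t)
       (eb : b' =1 b \o t) (ei : e = c i)
       (ebr : splice_col c b' =1 splice_col c b \o r),
       comp P ei p (act P t_bij eb q) = act P r_bij ebr (comp P ei p q)).
Proof.
move=> t_bij'; have id_bij : bijective (@id I) by exists id.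
exists (splice_map t (bij_inj id_bij) (i := i)), (splice_map_bij i id_bij t_bij' (bij_inj id_bij)).
split; first by move=> C c b b' eb [[x xi]|y] //=; rewrite eb.
move=> P c b b' d e p q t_bij eb ei ebr.
rewrite -{1}(act_id P p id_bij (fun=> erefl)).
by rewrite (Prop_irrelevance t_bij t_bij'); exact: comp_act.
Qed.

Section Free.
Variables (T : tree) (P : operad) (f : edge T -> colour P).
Variable g : forall v : vertex T,
  @op P {x : edge T | x \in inputs v} (f \o val) (f (out v)).

Definition vcol (v : vertex T) (x : {x : edge T | x \in inputs v}) : edge T := val x.

Inductive ev (e : edge T) :
  nat -> forall (I : finType) (c : I -> edge T), @op P I (f \o c) (f e) -> Prop :=
| ev_unit0 (I : finType) (c : I -> edge T) (s : I -> unit) (bij : bijective s)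
    (ec0 : c =1 fun=> e) (ec : f \o c =1 (fun=> f e) \o s) :
    @ev e 0 I c (act P bij ec (unit_op P (f e)))
| ev_graft0 n (I : finType) (c : I -> edge T) (p : @op P I (f \o c) (f e)) (i : I)
    (v : vertex T) (vi : out v = c i) (vi' : f (out v) = f (c i))
    (J : finType) (c' : J -> edge T)
    (s : J -> splice {x : edge T | x \in inputs v} i) (bij : bijective s)
    (ec0 : c' =1 splice_col c (@vcol v) \o s)
    (ec : f \o c' =1 splice_col (f \o c) (f \o val) \o s) :
    @ev e n I c p -> @ev e n.+1 J c' (act P bij ec (comp P vi' p (g v))).

Arguments ev e n {I c} p.

Lemma ev_act e n (I J : finType) (c : I -> edge T) (c' : J -> edge T) p
    (s : J -> I) (bij : bijective s) (ec0 : c' =1 c \o s) (ec : f \o c' =1 (f \o c) \o s) :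
  ev e n p -> ev e n (c := c') (act P bij ec p).
Proof.
move=> evp; case: n I c p / evp s bij ec0 ec.
  move=> I c t t_bij ect0 ect s bij ec0 ec.
  have ec' : f \o c' =1 (fun=> f e) \o (t \o s) by move=> x /=; rewrite ec0 /= ect0.
  rewrite (act_act _ _ _ _ (bij_comp t_bij bij) _ _ ec').
  by apply: ev_unit0 => x; rewrite ec0 /= ect0.
move=> n I c p i v vi vi' K c'' t t_bij ect0 ect evp s bij ec0 ec.
have ec' : f \o c' =1 splice_col (f \o c) (f \o val) \o (t \o s).
  by move=> x /=; rewrite ec0; exact: ect.
rewrite (act_act _ _ _ _ (bij_comp t_bij bij) _ _ ec').
by apply: ev_graft0 => // x; rewrite ec0 /= ect0.
Qed.

Lemma ev_tree_op e n (I : finType) (c : I -> edge T) p : ev e n (c := c) p -> tree_op c e.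
Proof.
move=> evp; elim: n I c p / evp => [I c s bij ec _|n I c p i v vi _ J c' s bij ec _ _ IH].
  by apply: (tree_op_act bij _ (tree_op_unit e)) => x; rewrite ec.
exact: (tree_op_act bij ec (tree_op_comp vi IH (tree_op_vertex v))).
Qed.

Lemma ev_eq e n (I : finType) (c : I -> edge T) (p q : @op P I (f \o c) (f e)) :
  ev e n p -> p = q -> ev e n q.
Proof. by move=> ? <-. Qed.

Lemma ev_unit e : ev e 0 (c := fun _ : unit => e) (unit_op P (f e)).
Proof.
have bij : bijective (@id unit) by exists id.
apply: ev_eq (ev_unit0 (c := fun=> e) (s := id) bij (fun=> erefl) (fun=> erefl)) _.
exact: act_id.
Qed.

Lemma f_splice (I J : finType) (i : I) (c : I -> edge T) (b : J -> edge T) :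
  f \o splice_col (i := i) c b =1 splice_col (i := i) (f \o c) (f \o b).
Proof. by case. Qed.

Lemma ev_graft e n (I : finType) (c : I -> edge T) (p : @op P I (f \o c) (f e)) (i : I)
    (v : vertex T) (vi' : f (out v) = f (c i)) (bij : bijective id) 
    (ec : f \o splice_col (i := i) c (@vcol v) =1 splice_col (f \o c) (f \o val) \o id) :
  out v = c i -> ev e n p ->
  ev e n.+1 (act P bij ec (comp P vi' p (g v))).
Proof. by move=> vi; apply: ev_graft0. Qed.

Definition internal (e : edge T) (I : finType) (c : I -> edge T) (v : vertex T) :=
  above (out v) e /\ forall i, ~ above (out v) (c i).

Lemma ev_extract e n (I : finType) (c : I -> edge T) p v :
  ev e n (c := c) p -> internal e c v -> (forall x, x \in inputs v -> exists i, c i = x) ->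
  exists n' (K : finType) (a : K -> edge T) (q : @op P K (f \o a) (f e)) (k : K)
    (vk' : f (out v) = f (a k))
    (s : I -> splice {x : edge T | x \in inputs v} k) (bij : bijective s)
    (ec : f \o c =1 splice_col (f \o a) (f \o val) \o s),
  [/\ n = n'.+1, ev e n' q, out v = a k, c =1 splice_col a (@vcol v) \o s
    & p = act P bij ec (comp P vk' q (g v))].
Proof.
move=> evp; elim: n I c p / evp => [I c s [s' _ ss'] ec0 ec [ve /(_ (s' tt)) []]|].
  by rewrite ec0.
move=> n I c p i w wi wi' J c' s bij ec0 ec evp IH [ve vc] vin.
have [c_inj cS] := ev_tree_op evp.
have [e_wv|wv] := eqVneq w v.
  case: _ / e_wv ve vc vin => ve vc vin.
  by exists n, I, c, p, i, wi', s, bij, ec.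
have [s' ss' s's] := bij.
have cs z : splice_col c (@vcol w) z = c' (s' z) by rewrite ec0 /= s's.
have vw : ~ above (out v) (out w).
  move=> /above_inputs; rewrite (inj_eq (@out_inj T)) eq_sym wv => /(_ isT)[y yw vy].
  by apply: (vc (s' (inr (exist _ y yw)))); rewrite -cs.
have v_int : internal e c v.
  split=> // j; have [-> |ji] := eqVneq j i; first by rewrite -wi.
  by have := vc (s' (inl (exist _ j ji))); rewrite -cs.
have vin' x : x \in inputs v -> exists j, c j = x.
  move=> xv; have [j] := vin x xv; rewrite ec0 /=; case: (s j) => [y|y] /= yx.
    by exists (val y).
  have := valP y; rewrite /= -[val y]/(@vcol w y) yx; move: xv; rewrite !inE => /eqP ->.
  by move=> /eqP[vw']; case/eqP: wv; rewrite vw'.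
have [n' [K [a [q [k [vk' [t [t_bij [ec1 [-> evq vk ec10 pq]]]]]]]]]] := IH v_int vin'.
have [m m_eq] : exists m, t i = inl m.
  case ti: (t i) => [m|y]; first by exists m.
  have iv : c i \in inputs v by rewrite ec10 /= ti; exact: (valP y).
  have [j] := vin (c i) iv; rewrite ec0 /=; case: (s j) => [z|z] /=.
    by move/c_inj => zi; have := valP z; rewrite /= zi eqxx.
  by rewrite -wi => zw; have := input_neq (valP z); rewrite /= -[val z]/(@vcol w z) zw eqxx.
have wm : out w = a (val m) by rewrite wi ec10 /= m_eq.
have wm' : f (out w) = f (a (val m)) by rewrite wm.
have id_bij (A : finType) : bijective (@id A) by exists id.
have ecw : f \o splice_col (i := val m) a (@vcol w) =1
  splice_col (f \o a) (f \o val) \o id by case.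
pose q' := act P (id_bij _) ecw (comp P wm' q (g w)).
have evq' : ev e n'.+1 q' by exact: ev_graft.
pose m' : splice {x : edge T | x \in inputs w} (val m) := inl (splice_swap m).
have vm' : f (out v) = f (splice_col (i := val m) a (@vcol w) m') by exact: vk'.
have [r [r_bij [rcol rP]]] := comp_actl {x : edge T | x \in inputs w} t_bij m_eq.
have [r2 [r2_bij [r2col r2P]]] :=
  comp_actl {x : edge T | x \in inputs v} (s := id) (id_bij _) (erefl m').
have ec_r := rcol _ (splice_col (f \o a) (f \o val)) (f \o @vcol w) (f \o c) ec1.
have ec_r2 := r2col _ (splice_col (f \o a) (f \o @vcol w)) (f \o @vcol v)
  (f \o splice_col (i := val m) a (@vcol w)) ecw.
have := r2P P _ _ _ _ _ (comp P wm' q (g w)) (g v) (id_bij _) ecw vm' vk' ec_r2.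
rewrite -/q' => /esym/actK[t2 [t2_bij [ec_t2 [r2t2 q'E]]]].
have ec_par : splice_col (splice_col (f \o a) (f \o @vcol v)) (f \o @vcol w)
    =1 splice_col (splice_col (f \o a) (f \o @vcol w)) (f \o @vcol v)
       \o @splice_par K {x : edge T | x \in inputs v} {x : edge T | x \in inputs w} k m.
  by case=> [[[[x xi]|y] xk]|z].
have pE : act P bij ec (comp P wi' p (g w)) =
    act P (bij_comp t2_bij (bij_comp (splice_par_bij _ _ m) (bij_comp r_bij bij)))
      (fun x => etrans (ec x) (etrans (ec_r _) (etrans (ec_par _) (ec_t2 _))))
      (comp P vm' q' (g v)).
  rewrite pq (rP _ _ _ _ _ _ _ _ _ _ wi' wm' ec_r).
  rewrite -(comp_par P q (g v) (g w) vk' wm' (splice_par_bij _ _ m) ec_par) -q'E.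
  by rewrite !act_actE; exact: act_eq.
exists n'.+1, _, _, q', m', vm', _, (bij_comp t2_bij (bij_comp (splice_par_bij _ _ m) (bij_comp r_bij bij))),
  (fun x => etrans (ec x) (etrans (ec_r _) (etrans (ec_par _) (ec_t2 _)))); split;
  [by [] | exact: evq' | exact: vk | | exact: pE].
have t2r2 : cancel t2 r2 by exact: (bij_can_sym r2_bij t2).2 r2t2.
move=> x; rewrite ec0 /= (rcol _ _ (@vcol w) _ ec10) /=.
have ec_par' : splice_col (splice_col a (@vcol v)) (@vcol w)
    =1 splice_col (splice_col a (@vcol w)) (@vcol v)
       \o @splice_par K {x : edge T | x \in inputs v} {x : edge T | x \in inputs w} k m.
  by case=> [[[[y yi]|y] yk]|z].
rewrite ec_par' /= -[in LHS](t2r2 (splice_par _)).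
exact: esym (r2col _ (splice_col a (@vcol w)) (@vcol v) _ (fun=> erefl) _).
Qed.

Lemma ev0 e n (I : finType) (c : I -> edge T) p : ev e n (c := c) p -> n = 0 ->
  c =1 (fun=> e) /\ exists (s : I -> unit) (bij : bijective s)
    (ec : f \o c =1 (fun=> f e) \o s), p = act P bij ec (unit_op P (f e)).
Proof.
by move=> evp; case: n I c p / evp => // I c s bij ec0 ec _; split=> //; exists s, bij, ec.
Qed.

Lemma ev_top e n (I : finType) (c : I -> edge T) p : ev e n (c := c) p -> 0 < n ->
  exists2 v, internal e c v & forall x, x \in inputs v -> exists i, c i = x.
Proof.
move=> evp; case: n I c p / evp => // n I c p i v vi vi' J c' s [s' ss' s's] ec0 ec evp _.
have [c_inj cS] := ev_tree_op evp; have cI x : c x \in [set c i | i in I] by exact: imset_f.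
exists v; last by move=> x xv; exists (s' (inr (exist _ x xv))); rewrite ec0 /= s's.
split=> [|j]; first by rewrite vi; exact: subtree_above cS (cI i).
rewrite ec0 /=; case: (s j) => [x|y] /=.
  rewrite vi => /(subtree_anti cS (cI _) (cI _))/c_inj ix.
  by have := valP x; rewrite /= -ix eqxx.
move=> vy; have := input_neq (valP y).
by rewrite (above_anti (above_input (valP y)) vy) eqxx.
Qed.

Lemma graft_sub (v : vertex T) (I K K' : finType) (c : I -> edge T) (a : K -> edge T)
    (a' : K' -> edge T) (k : K) (k' : K')
    (s : I -> splice {x : edge T | x \in inputs v} k)
    (s' : I -> splice {x : edge T | x \in inputs v} k') :
  injective c -> bijective s -> bijective s' -> out v = a k -> out v = a' k' ->
  c =1 splice_col a (@vcol v) \o s -> c =1 splice_col a' (@vcol v) \o s' ->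
  forall x', {x | a x = a' x'}.
Proof.
move=> c_inj s_bij s'_bij vk vk' ec ec' x'; apply: cid; case: s'_bij => u' su' us'.
have [->|x'k] := eqVneq x' k'; first by exists k; rewrite -vk.
have := ec (u' (inl (exist _ x' x'k))); rewrite {1}ec' /= us' /=.
case: (s _) => [x|y] /= xy; first by exists (val x).
have : u' (inl (exist (fun x' => x' != k') x' x'k)) = u' (inr y).
  by apply: c_inj; rewrite !ec' /= !us' /= xy.
by move/(can_inj us').
Qed.

Lemma ev_uniq e n m (I : finType) (c : I -> edge T) p q :
  ev e n (c := c) p -> ev e m (c := c) q -> n = m /\ p = q.
Proof.
elim: n m I c p q => [|n IH] m I c p q evp evq.
  have [ce [s [s_bij [ec ->]]]] := ev0 evp erefl.
  have m0 : m = 0.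
    case: m evq => // m /ev_top /(_ isT)[v [ve vc] _].
    by case: s_bij => s' _ _; case: (vc (s' tt)); rewrite ce.
  have [_ [s' [s'_bij [ec' ->]]]] := ev0 evq m0.
  by split=> //; apply: act_eq => x; case: (s x); case: (s' x).
have [v vint vin] := ev_top evp isT.
have [c_inj cS] := ev_tree_op evp.
have [n1 [K [a [p0 [k [vk [s [s_bij [ec [[<-] evp0 vk0 ec0 ->]]]]]]]]]] :=
  ev_extract evp vint vin.
have [m1 [K' [a' [q0 [k' [vk' [s' [s'_bij [ec' [mE evq0 vk0' ec0' ->]]]]]]]]]] :=
  ev_extract evq vint vin.
have [a_inj aS] := ev_tree_op evp0; have [a'_inj a'S] := ev_tree_op evq0.
pose t x := sval (graft_sub c_inj s_bij s'_bij vk0 vk0' ec0 ec0' x).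
have tE x : a (t x) = a' x by rewrite /t; case: graft_sub.
pose u x := sval (graft_sub c_inj s'_bij s_bij vk0' vk0 ec0' ec0 x).
have uE x : a' (u x) = a x by rewrite /u; case: graft_sub.
have t_bij : bijective t.
  by exists u => x; [apply: a'_inj; rewrite uE tE | apply: a_inj; rewrite tE uE].
have et0 : a' =1 a \o t by move=> x; rewrite /= tE.
have et : f \o a' =1 (f \o a) \o t by move=> x; rewrite /= tE.
have [nm1 pq0] := IH _ _ _ _ _ (ev_act t_bij et0 et evp0) evq0.
split; first by rewrite mE nm1.
have tk : t k' = k by apply: a_inj; rewrite tE -vk0'.
have [r [r_bij [rcol rP]]] := comp_actl {x : edge T | x \in inputs v} t_bij tk.
have ec_r := rcol _ (f \o a) (f \o @vcol v) (f \o a') et.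
rewrite -pq0 (rP _ _ _ _ _ _ _ _ _ _ vk' vk ec_r) act_actE; apply: act_eq => x.
have [col_inj _] := tree_op_comp vk0 (conj a_inj aS) (tree_op_vertex v).
by apply: col_inj; rewrite -[LHS]ec0 ec0' /= (rcol _ a _ a' et0).
Qed.

Lemma ev_ex (e : edge T) (I : finType) (c : I -> edge T) :
  tree_op c e -> exists n p, ev e n (c := c) p.
Proof.
case=> c_inj; move cA: [set c i | i : I] => A eA.
elim: eA I c c_inj cA => [|{}A v eA IH vA] I c c_inj cA.
  have [i ci] : exists i, c i = e.
    by have /imsetP[i _ ei] : e \in [set c i | i in I]; [rewrite cA set11 | exists i].
  have ce : c =1 fun=> e by move=> j; apply/set1P; rewrite -cA imset_f.
  have bij : bijective (fun _ : I => tt).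
    by exists (fun=> i) => [j|[]] //; apply: c_inj; rewrite !ce.
  have ec : f \o c =1 (fun=> f e) \o fun=> tt by move=> j; rewrite /= ce.
  by exists 0, (act P bij ec (unit_op P (f e))); exact: ev_unit0.
pose a (x : {x : edge T | x \in A}) := val x.
have a_im : [set a i | i : {x : edge T | x \in A}] = A.
  apply/setP => x; apply/imsetP/idP => [[y _ ->]|xA]; first exact: (valP y).
  by exists (exist _ x xA).
have [n [p evp]] := IH _ a val_inj a_im.
pose i : {x : edge T | x \in A} := exist _ (out v) vA.
have vi : out v = a i by [].
have [g_inj g_sub] := tree_op_comp vi (ev_tree_op evp) (tree_op_vertex v).
have ex x : {y | splice_col (i := i) a (@vcol v) y = c x}.
  apply: cid; have : c x \in (A :\ out v) :|: inputs v by rewrite -cA imset_f.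
  rewrite in_setU in_setD1 => /orP[/andP[xv xA]|xv]; last by exists (inr (exist (fun x => x \in inputs v) (c x) xv)).
  have xi : exist (fun x => x \in A) (c x) xA != i by rewrite -val_eqE.
  by exists (inl (exist (fun x => x != i) _ xi)).
have ex' y : {x | c x = splice_col (i := i) a (@vcol v) y}.
  apply: cid; have : splice_col (i := i) a (@vcol v) y \in [set c i | i : I].
    rewrite cA in_setU in_setD1; case: y => [x|y] /=; last by rewrite (valP y) orbT.
    by have := valP x; rewrite /= -val_eqE /= => ->; rewrite (valP (val x)).
  by case/imsetP => x _ ->; exists x.
pose s x := sval (ex x); pose s' y := sval (ex' y).
have sE x : splice_col (i := i) a (@vcol v) (s x) = c x by exact: (svalP (ex x)).
have s'E y : c (s' y) = splice_col (i := i) a (@vcol v) y by exact: (svalP (ex' y)).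
have s_bij : bijective s.
  by exists s' => x; [apply: c_inj; rewrite s'E sE | apply: g_inj; rewrite -[LHS]/(splice_col (i := i) a (@vcol v) _) sE s'E].
have ec0 : c =1 splice_col a (@vcol v) \o s by move=> x; rewrite /= sE.
have ec : f \o c =1 splice_col (f \o a) (f \o val) \o s.
  by move=> x; rewrite /= -sE; case: (s x).
exists n.+1, (act P s_bij ec (comp P (erefl : f (out v) = f (a i)) p (g v))).
exact: ev_graft0.
Qed.

Definition free_omap (I : finType) (c : I -> edge T) (e : edge T) (ce : tree_op c e) :
  @op P I (f \o c) (f e) := sval (cid (let: ex_intro n h := ev_ex ce in
    let: ex_intro p evp := h in ex_intro _ p (ex_intro _ n evp) :
      exists p : @op P I (f \o c) (f e), exists n, ev e n p)).

Lemma free_omapE e n (I : finType) (c : I -> edge T) (ce : tree_op c e) p :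
  ev e n (c := c) p -> free_omap ce = p.
Proof. by rewrite /free_omap; case: cid => /= q [m evq] evp; have [] := ev_uniq evq evp. Qed.

Lemma free_omap_ev e (I : finType) (c : I -> edge T) (ce : tree_op c e) :
  exists n, ev e n (free_omap ce).
Proof. by rewrite /free_omap; case: cid. Qed.

Lemma ev_comp e n m (I J : finType) (c : I -> edge T) (b : J -> edge T) d (i : I)
    p q (ei : d = c i) (ei' : f d = f (c i)) (id_bij : bijective id)
    (ec : f \o splice_col c b =1 splice_col (i := i) (f \o c) (f \o b) \o id) :
  ev e n (c := c) p -> ev d m (c := b) q ->
  exists k, ev e k (c := splice_col c b) (act P id_bij ec (comp P ei' p q)).
Proof.
move=> evp evq; elim: m J b q / evq ei' id_bij ec.
  move=> J b s s_bij eb0 eb ei' id_bij ec; move: (esym ei) => ei0; case: d / ei0 ei ei' eb0 eb ec => _ ei' eb0 eb ec.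
  rewrite (Prop_irrelevance ei' erefl).
  have [r [r_bij [rcol rP]]] := comp_actr i s_bij.
  have ec_r := rcol _ (f \o c) (fun=> f (c i)) (f \o b) eb.
  have ecu C (h : I -> C) : h =1 splice_col h (fun=> h i) \o splice_unit i.
    move=> x; rewrite /= /splice_unit; case: insubP => [y _ <-//|].
    by move/negPn/eqP ->.
  have [t [t_bij [ec_t [tu pE]]]] := actK (comp_unitr (i := i) P p (splice_unit_bij i) (ecu _ (f \o c))).
  rewrite (rP _ _ _ _ _ _ _ _ _ _ _ ec_r) -pE !act_actE.
  exists n; apply: ev_act => // x /=.
  rewrite (rcol _ c (fun=> c i) b eb0) /=.
  have ut : cancel t (splice_unit i) by exact: (bij_can_sym (splice_unit_bij i) t).2 tu.
  exact: esym (etrans (ecu _ c _) (congr1 (splice_col c (fun=> c i)) (ut (r x)))).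
move=> m J b q j v vj vj' K b' s s_bij eb0 eb evq IH ei' id_bij ec.
pose V : finType := {x : edge T | x \in inputs v}.
have idb (A : finType) : bijective (@id A) by exists id.
have ec1 : f \o splice_col c b =1 splice_col (i := i) (f \o c) (f \o b) \o id by case.
have [k evpq] := IH ei' (idb _) ec1.
have [r [r_bij [rcol rP]]] := comp_actr i s_bij.
have ec_r := rcol _ (f \o c) (splice_col (f \o b) (f \o @vcol v)) (f \o b') eb.
pose j' : splice J i := inr j.
have vj'' : out v = splice_col c b j' by [].
have [r2 [r2_bij [r2col r2P]]] := comp_actl V (s := id) (idb _) (erefl j').
have ec_r2 := r2col _ (splice_col (f \o c) (f \o b)) (f \o @vcol v)
  (f \o splice_col (i := i) c b) ec1.
have := r2P P _ _ _ _ _ (comp P ei' p q) (g v) (idb _) ec1 vj' vj' ec_r2.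
move=> /esym/actK[t2 [t2_bij [ec_t2 [r2t2 pqE]]]].
have ec_seq : splice_col (f \o c) (splice_col (f \o b) (f \o @vcol v))
    =1 splice_col (splice_col (f \o c) (f \o b)) (f \o @vcol v)
       \o @splice_seq I J V i j by case=> [x|[[y yj]|z]].
rewrite (rP _ _ _ _ _ _ _ _ _ _ _ ec_r).
rewrite -(comp_seq P p q (g v) ei' vj' (splice_seq_bij _ i j) ec_seq) -pqE !act_actE.
exists k.+1; apply: ev_graft0 evpq => // x /=.
have t2r2 : cancel t2 r2 by exact: (bij_can_sym r2_bij t2).2 r2t2.
rewrite (rcol _ c _ b' eb0) /=.
have ec_seq' : splice_col c (splice_col b (@vcol v))
    =1 splice_col (splice_col (i := i) c b) (@vcol v) \o @splice_seq I J V i j.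
  by case=> [y|[[y yj]|z]].
rewrite ec_seq' /= -[in LHS](t2r2 (splice_seq _)).
exact: esym (r2col _ (splice_col c b) (@vcol v) _ (fun=> erefl) _).
Qed.

Definition vertex_op (v : vertex T) : @op (omega T) _ (@vcol v) (out v) := tree_op_vertex v.

Definition free_map : operad_map (omega T) P.
Proof.
refine (@OperadMap (omega T) P f (fun I c e ce => free_omap ce) _ _ _).
- by move=> e; exact: free_omapE (ev_unit e).
- move=> I J c c' e s s_bij ec ec' ce; have [n evc] := free_omap_ev ce.
  exact: free_omapE (ev_act s_bij ec ec' evc).
- move=> I J c b d e i ei ei' id_bij ec cd be.
  have [n evc] := free_omap_ev cd; have [m evb] := free_omap_ev be.
  by have [k] := ev_comp ei ei' id_bij ec evc evb; exact: free_omapE.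
Defined.

Lemma free_map_vertex v : omap free_map (vertex_op v) = g v.
Proof.
have idb (A : finType) : bijective (@id A) by exists id.
pose V : finType := {x : edge T | x \in inputs v}.
have ec1 : f \o splice_col (i := tt) (fun=> out v) (@vcol v) =1
   splice_col (fun=> f (out v)) (f \o @vcol v) \o id by case.
have ec2 : f \o @vcol v =1 (f \o splice_col (i := tt) (fun=> out v) (@vcol v)) \o inr by [].
have := ev_act (c' := @vcol v) (splice_unitl_bij V) _ ec2
  (ev_graft (i := tt) (v := v) erefl (idb _) ec1 erefl (ev_unit (out v))).
move=> /(_ (fun=> erefl)); rewrite act_actE => /(free_omapE (tree_op_vertex v)) /= ->.
rewrite -[RHS](comp_unitl P (g v) (splice_unitl_bij V) (fun=> erefl)).
exact: act_eq.
Qed.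

End Free.

Arguments ev {T P f} g e n {I c} p.

Lemma ev_omap (T : tree) (P : operad) (F : operad_map (omega T) P) e n (I : finType)
    (c : I -> edge T) p (ce : tree_op c e) :
  ev (fun v => omap F (vertex_op v)) e n (c := c) p -> omap F (ce : @op (omega T) I c e) = p.
Proof.
have id_bij (A : finType) : bijective (@id A) by exists id.
move=> evp; elim: n I c p / evp ce.
  move=> I c s bij ec0 ec ce; rewrite -omap_unit.
  rewrite (omega_thin ce (act (omega T) bij ec0 (unit_op (omega T) e))).
  exact: (omap_act F bij ec0 ec (unit_op (omega T) e)).
move=> n I c p i v vi vi' J c' s bij ec0 ec evp IH ce.
have cpe := ev_tree_op evp; rewrite -(IH cpe).
rewrite (omega_thin ce (act (omega T) bij ec0 (comp (omega T) vi (cpe : @op (omega T) I c e) (vertex_op v)))).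
have ec1 : cmap F \o splice_col c (@vcol T v) =1
  splice_col (i := i) (cmap F \o c) (cmap F \o @vcol T v) \o id by case.
have ec2 : cmap F \o c' =1 (cmap F \o splice_col (i := i) c (@vcol T v)) \o s.
  by move=> x; rewrite /= ec0.
rewrite (omap_act F bij ec0 ec2) (omap_comp F vi vi' (id_bij _) ec1) act_actE.
exact: act_eq.
Qed.

(* The universal property of the free operad: a map out of [omega T] is uniquely
   determined by arbitrary values on edges and vertices. *)
Theorem omega_free (T : tree) (P : operad) (f : edge T -> colour P)
    (g : forall v : vertex T, @op P _ (f \o @vcol T v) (f (out v))) :
  exists! F : operad_map (omega T) P, exists e : cmap F = f, forall v : vertex T,
    eq_rect _ (fun h => op (h \o @vcol T v) (h (out v))) (omap F (vertex_op v)) _ e = g v.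
Proof.
exists (free_map g); split; first by exists erefl => v; exact: free_map_vertex.
move=> F [e]; case: _ / e g => g Fg; apply: esym.
have {Fg} -> : g = fun v => omap F (vertex_op v).
  by apply: functional_extensionality_dep => v; rewrite -Fg.
apply: operad_map_eq => // I c e ce eFG; rewrite (Prop_irrelevance eFG erefl) /=.
have [n evc] := free_omap_ev (fun v => omap F (vertex_op v)) ce.
exact: ev_omap evc.
Qed.

Definition eta : tree.
Proof.
refine (@Tree unit void tt (fun v => match v with end) (fun=> None) _ _ _).
- by case.
- by case.
- by case; exists 0.
Defined.

Definition edge_map (T : tree) (x : edge T) : operad_map (omega eta) (omega T).
Proof. by apply: (@omega_map eta T (fun=> x)); case. Defined.

Section InnerFace.
Variables (T : tree) (e : edge T) (inner_e : inner e).

(* T/e, with edge set E - {e}: the vertex above [e] disappears and its inputs become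
   inputs of the vertex below [e]. *)
Definition contract_dest (x : {x : edge T | x != e}) : option {u : vertex T | out u != e} :=
  obind insub (if dest (val x) is Some u then (if out u == e then dest e else Some u)
               else None).

Lemma root_neq_inner : root T != e.
Proof. by apply: contraTneq inner_e => <-; rewrite /inner destP eqxx andbF. Qed.

Definition contract_root : {x : edge T | x != e} :=
  exist (fun x => x != e) (root T) root_neq_inner.

Lemma contract_destP x : (contract_dest x == None) = (x == contract_root).
Proof.
rewrite -val_eqE /= -destP /contract_dest.
case xu: (dest (val x)) => [u|] //=; case: (eqVneq (out u) e) => [ue|une] /=.
  case ev: (dest e) => [v|] /=; last by move: inner_e; rewrite /inner ev andbF.
  have ve : out v != e.
    by rewrite eq_sym; apply: input_neq; rewrite inE ev.
  by rewrite insubT.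
by rewrite insubT.
Qed.

Definition contract_out (u : {u : vertex T | out u != e}) : {x : edge T | x != e} :=
  exist _ (out (val u)) (valP u).

Lemma contract_out_inj : injective contract_out.
Proof. by move=> u v [/out_inj/val_inj]. Qed.

Lemma contract_down x :
  val (if contract_dest x is Some v then contract_out v else x) =
    if down (val x) == e then down e else down (val x).
Proof.
rewrite /contract_dest; case xu: (dest (val x)) => [u|] /=; last first.
  by rewrite /down xu (negPf (valP x)).
have -> : down (val x) = out u by rewrite /down xu.
case: (eqVneq (out u) e) => [ue|une] /=; last by rewrite insubT.
case ev: (dest e) => [v|] /=; last by move: inner_e; rewrite /inner ev andbF.
have ve : out v != e by rewrite eq_sym; apply: input_neq; rewrite inE ev.
by rewrite insubT /= /down ev.
Qed.

Lemma contract_rooted (x : {x : edge T | x != e}) : exists n : nat,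
  iter n (fun y => if contract_dest y is Some v then contract_out v else y) x
    = contract_root.
Proof.
have [n] := above_root (val x); elim/ltn_ind: n x => -[|n] IH x xn.
  by exists 0; apply: val_inj.
have [m mn mx] : exists2 m, m < n.+1 &
    iter m (@down T) (val (if contract_dest x is Some v then contract_out v else x))
      = root T.
  rewrite contract_down; move: xn; rewrite iterSr.
  have [xe|_] := eqVneq (down (val x)) e; last by exists n.
  case: n {IH} => [|n]; first by rewrite xe /= => er; case/eqP: root_neq_inner.
  by rewrite iterSr xe; exists n.
by have [k kP] := IH m mn _ mx; exists k.+1; rewrite iterSr.
Qed.

Definition contract : tree :=
  @Tree {x : edge T | x != e} {u : vertex T | out u != e}
    contract_root contract_out contract_dest
    contract_out_inj contract_destP contract_rooted.

Definition inner_face : operad_map (omega contract) (omega T).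
Proof.
apply: (@omega_map contract T (fun x => val x)) => u; split.
  by move=> x y /val_inj/val_inj.
have st_u := subtree_vertex (val u).
have [ue|une] := boolP (e \in inputs (val u)); last first.
  rewrite (_ : [set _ | _ in _] = inputs (val u)) //.
  apply/setP => y; apply/imsetP/idP => [[x _ ->]|yu].
    have := valP x; rewrite inE /= /contract_dest.
    case xw: (dest _) => [w|] //=; case: (eqVneq (out w) e) => [we|wne] /=.
      case ev: (dest e) => [v|] //=; case: insubP => //= v' _ vv' /eqP[vu].
      by rewrite inE ev -vv' vu eqxx in une.
    by case: insubP => //= w' _ ww' /eqP[wu]; rewrite inE xw -ww' wu.
  have ye : y != e by apply/eqP => ye; rewrite ye (negPf une) in yu.
  have yP : exist _ y ye \in @inputs contract u.
    move: yu; rewrite !inE /= /contract_dest => /eqP -> /=; rewrite (negPf (valP u)) /=.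
    by rewrite valK.
  by exists (exist (fun x => x \in @inputs contract u) (exist _ y ye) yP).
have [w we] : exists w, out w = e.
  by move: inner_e => /andP[/codomP[w ->] _]; exists w.
move: (ue); rewrite inE => /eqP eu.
have := subtree_graft (v := w) st_u; rewrite we => /(_ ue).
congr subtree; apply/setP => y; rewrite in_setU in_setD1; apply/idP/imsetP.
  move=> yuw; have ye : y != e.
    by case/orP: yuw => [/andP[]//|/input_neq]; rewrite we.
  have yP : exist _ y ye \in @inputs contract u.
    rewrite inE /= /contract_dest /=; move: yuw; rewrite ye !inE /=.
    case/orP => /eqP -> /=; last by rewrite we eqxx eu /= valK.
    by rewrite (negPf (valP u)) /= valK.
  by exists (exist (fun x => x \in @inputs contract u) (exist _ y ye) yP).
case=> x _ ->; rewrite (valP (val x)) /=.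
have := valP x; rewrite !inE /= /contract_dest.
case xw: (dest _) => [w'|] //=; case: (eqVneq (out w') e) => [we'|wne] /=.
  by move=> _; rewrite (@out_inj _ w' w) ?eqxx ?orbT // we'.
by case: insubP => //= w'' _ ww /eqP[<-]; rewrite ww eqxx.
Defined.

End InnerFace.

Definition attached (T : tree) (v : vertex T) : {set edge T} := out v |: inputs v.

Definition outer_vertex (T : tree) (v : vertex T) : bool :=
  #|[set x in attached v | inner x]| == 1.

Section OuterFace.
Variables (T : tree) (v : vertex T) (outer_v : outer_vertex v).

Definition kept : pred (edge T) := fun x => ~~ ((x \in attached v) && ~~ inner x).

Lemma kept_out (u : {u : vertex T | u != v}) : kept (out (val u)).
Proof.
rewrite /kept /attached in_setU1 inj_eq; last exact: out_inj.
rewrite (negPf (valP u)) /= inE /inner codom_f /=.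
by case: (dest _) => [w|] //=; rewrite andbF.
Qed.

(* The root edge of T/v is that of T unless [v] is the root vertex, in which case it is
   the inner input of [v]. *)
Definition prune_root_edge : edge T :=
  odflt (root T) [pick x in inputs v | inner x].

Definition prune_out (u : {u : vertex T | u != v}) : {x : edge T | kept x} :=
  exist kept (out (val u)) (kept_out u).

Definition prune_dest (x : {x : edge T | kept x}) : option {u : vertex T | u != v} :=
  obind insub (dest (val x)).

Lemma prune_root_kept : kept prune_root_edge.
Proof.
rewrite /prune_root_edge /kept; case: pickP => [x /andP[_ ->]|no_in] /=.
  by rewrite andbF.
rewrite negb_and negbK; apply/orP; left; rewrite in_setU1 negb_or.
have rT : dest (root T) = None by apply/eqP; rewrite destP.
rewrite inE rT andbT; apply/negP => /eqP rv.
move: outer_v => /cards1P[y /setP/(_ y)]; rewrite !inE eqxx.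
case/andP => /orP[/eqP ->|yv] yin; first by move: yin; rewrite /inner -rv rT andbF.
by move: (no_in y); rewrite inE yv yin.
Qed.

Definition prune_root : {x : edge T | kept x} := exist kept prune_root_edge prune_root_kept.

Lemma prune_destP x : (prune_dest x == None) = (x == prune_root).
Proof.
rewrite -val_eqE /= /prune_root_edge /prune_dest; move: x => [x xk] /=; move: xk; rewrite /kept.
case xu: (dest x) => [u|] /=; last first.
  have xr : x = root T by apply/eqP; rewrite -destP xu.
  case: pickP => [y /andP[yv yin]|_] /=; last by rewrite xr !eqxx.
  have outv : out v = root T.
    apply/eqP; rewrite -destP; apply/negPn/negP => vin.
    case/cards1P: outer_v => z /setP zP; have := input_neq yv.
    have /set1P -> : y \in [set z] by rewrite -zP inE in_setU1 yv yin orbT.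
    have /set1P -> : out v \in [set z] by rewrite -zP inE in_setU1 eqxx /inner codom_f vin.
    by rewrite eqxx.
  by rewrite in_setU1 outv xr eqxx /inner destP eqxx andbF.
case: insubP => [u' uv _|/negPn/eqP uv] /= xk.
  apply/esym/eqP => xr; case: pickP xr => [y /andP[yv _] /= xy|_ /= xr].
    by move: yv; rewrite -xy inE xu (inj_eq (@Some_inj _)) (negPf uv).
  by have := destP (root T); rewrite -xr xu eqxx.
have xv : x \in inputs v by rewrite inE xu uv.
rewrite in_setU1 xv orbT /= negbK in xk; rewrite eqxx; apply/esym/eqP.
case: pickP => [y /andP[yv yin] /=|/(_ x)]; last by rewrite xv xk.
case/cards1P: outer_v => z /setP zP.
have /set1P -> : x \in [set z] by rewrite -zP inE in_setU1 xv xk orbT.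
have /set1P -> // : y \in [set z] by rewrite -zP inE in_setU1 yv yin orbT.
Qed.

Lemma prune_out_inj : injective prune_out.
Proof. by move=> u w [/out_inj/val_inj]. Qed.

Lemma prune_rooted (x : {x : edge T | kept x}) : exists n : nat,
  iter n (fun y => if prune_dest y is Some v then prune_out v else y) x
    = prune_root.
Proof.
have [n] := above_root (val x); elim: n x => [|n IH] x xn.
  exists 0; apply/eqP; rewrite -prune_destP /prune_dest.
  by move: xn => /eqP; rewrite -destP => /eqP ->.
case xw: (prune_dest x) => [w|].
  have [|k kP] := IH (prune_out w); last by exists k.+1; rewrite iterSr xw.
  move: xw xn; rewrite iterSr /prune_dest /down; case: (dest (val x)) => //= u.
  by case: insubP => //= u' _ <- [<-].
by exists 0; apply/eqP; rewrite -prune_destP xw.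
Qed.

Definition prune : tree :=
  @Tree {x : edge T | kept x} {u : vertex T | u != v}
    prune_root prune_out prune_dest
    prune_out_inj prune_destP prune_rooted.

Definition outer_face : operad_map (omega prune) (omega T).
Proof.
apply: (@omega_map prune T (fun x => val x)) => u; split.
  by move=> x y /val_inj/val_inj.
rewrite (_ : [set _ | _ in _] = inputs (val u)); first exact: subtree_vertex.
apply/setP => y; apply/imsetP/idP => [[x _ ->]|].
  have := valP x; rewrite !inE /= /prune_dest; case: (dest _) => //= w.
  by case: insubP => //= w' _ ww' /eqP[<-]; rewrite ww'.
move=> yu; have ky : kept y.
  rewrite /kept negb_and negbK in_setU1 negb_or.
  move: (yu); rewrite inE => /eqP yu'.
  rewrite inE yu' (inj_eq (@Some_inj _)) (valP u) andbT /inner yu' andbT orbC.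
  by case: (boolP (y \in _)) => //; apply: contraNneq => ->; exact: codom_f.
have yP : exist kept y ky \in @inputs prune u.
  by move: yu; rewrite !inE /= /prune_dest => /eqP /= -> /=; rewrite valK.
by exists (exist (fun x => x \in @inputs prune u) (exist kept y ky) yP).
Defined.

End OuterFace.

Variant face (T : tree) :=
| InnerFace (e : edge T) of inner e
| OuterFace (v : vertex T) of outer_vertex v
| EdgeFace (x : edge T) of #|vertex T| == 1.

Definition face_dom (T : tree) (phi : face T) : tree :=
  match phi with
  | InnerFace e he => contract he
  | OuterFace v hv => prune hv
  | EdgeFace _ _ => eta
  end.

Definition face_map (T : tree) (phi : face T) :
    operad_map (omega (face_dom phi)) (omega T) :=
  match phi with
  | InnerFace e he => inner_face he
  | OuterFace v hv => outer_face hv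
  | EdgeFace x _ => edge_map x
  end.

Definition is_inner_face (T : tree) (e : edge T) (phi : face T) : bool :=
  if phi is InnerFace e' _ then e' == e else false.

Record dset := DSet {
  dendrex :> tree -> Type;
  pull : forall S T : tree, operad_map (omega S) (omega T) -> dendrex T -> dendrex S;
  pull_id : forall (T : tree) (x : dendrex T), pull (operad_id (omega T)) x = x;
  pull_comp : forall (R S T : tree) (a : operad_map (omega R) (omega S))
    (b : operad_map (omega S) (omega T)) (x : dendrex T),
    pull (operad_comp b a) x = pull a (pull b x)
}.

Record dmap (X Y : dset) := DMap {
  dapp :> forall T : tree, X T -> Y T;
  dapp_pull : forall (S T : tree) (a : operad_map (omega S) (omega T)) (x : X T),
    dapp (pull a x) = pull a (dapp x)
}.

Program Definition dcomp (X Y Z : dset) (G : dmap Y Z) (F : dmap X Y) : dmap X Z :=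
  @DMap X Z (fun T x => G T (F T x)) _.
Next Obligation. by move=> X Y Z G F S T a x; exact: etrans (congr1 _ (dapp_pull F a x)) (dapp_pull G a _). Qed.

Lemma operad_comp1 (P Q : operad) (F : operad_map P Q) : operad_comp F (operad_id P) = F.
Proof.
by apply: operad_map_eq => // I c d f e; rewrite (Prop_irrelevance e erefl).
Qed.

Lemma operad_compA (P Q R S : operad) (H : operad_map R S) (G : operad_map Q R)
    (F : operad_map P Q) :
  operad_comp (operad_comp H G) F = operad_comp H (operad_comp G F).
Proof.
by apply: operad_map_eq => // I c d f e; rewrite (Prop_irrelevance e erefl).
Qed.

Definition nerve (P : operad) : dset :=
  @DSet (fun T => operad_map (omega T) P) (fun S T a x => operad_comp x a)
    (fun T x => operad_comp1 x) (fun R S T a b x => esym (operad_compA x b a)).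

Definition nerve_map (P Q : operad) (F : operad_map P Q) : dmap (nerve P) (nerve Q) :=
  @DMap (nerve P) (nerve Q) (fun T x => operad_comp F x)
    (fun S T a x => esym (operad_compA F x a)).

Definition representable (T : tree) : dset := 
  @DSet (fun S => operad_map (omega S) (omega T)) (fun R S a x => operad_comp x a)
    (fun S x => operad_comp1 x) (fun Q R S a b x => esym (operad_compA x b a)).

Definition in_horn (T : tree) (e : edge T) (S : tree) (a : representable T S) : Prop :=
  exists2 phi : face T, ~~ is_inner_face e phi &
    exists b : operad_map (omega S) (omega (face_dom phi)),
      a = operad_comp (face_map phi) b.

Lemma in_horn_comp (T : tree) (e : edge T) (R S : tree)
    (b : operad_map (omega R) (omega S)) (a : representable T S) :
  in_horn e a -> @in_horn T e R (operad_comp a b).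
Proof.
case=> phi phiP [a' aE]; exists phi => //.
by exists (operad_comp a' b); rewrite aE operad_compA.
Qed.

Program Definition horn (T : tree) (e : edge T) : dset :=
  @DSet (fun S => {a : representable T S | in_horn e a})
    (fun R S b a => exist _ (operad_comp (sval a) b) (in_horn_comp b (svalP a))) _ _.
Next Obligation. by move=> T e S [a aP]; apply: eq_exist; exact: operad_comp1. Qed.
Next Obligation.
by move=> T e Q R S b b' [a aP]; apply: eq_exist; exact: esym (operad_compA _ _ _).
Qed.

Definition horn_incl (T : tree) (e : edge T) : dmap (horn e) (representable T) :=
  @DMap (horn e) (representable T) (fun S a => sval a) (fun R S b a => erefl).

Definition inner_kan (K : dset) : Prop :=
  forall (T : tree) (e : edge T), inner e ->
  forall F : dmap (horn e) K, exists G : dmap (representable T) K,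
    dcomp G (horn_incl e) = F.

Definition corolla (I : finType) : tree.
Proof.
refine (@Tree (option I) unit None (fun=> None)
  (fun x => if x is Some _ then Some tt else None) _ _ _).
- by case=> -[].
- by case.
- by case=> [i|]; [exists 1 | exists 0].
Defined.

(* [None] is the edge 0 and [Some i] the edge i of the corolla. *)
Definition corolla_op (I : finType) : @op (omega (corolla I)) I Some None.
Proof.
split; first by move=> x y [].
rewrite (_ : [set _ | _ in _] = @inputs (corolla I) tt).
  exact: (@subtree_vertex (corolla I) tt).
apply/setP => -[x|]; rewrite inE /=; first by rewrite imset_f.
by apply/imsetP => -[].
Qed.

Lemma corolla_tree_op (I : finType) (T : tree) (f : option I -> edge T)  :
  tree_op (f \o Some) (f None) ->
  forall v : vertex (corolla I),
    tree_op (fun x : {x | x \in inputs v} => f (val x)) (f (out v)).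
Proof.
case=> f_inj fP -[].
have noN : None \in @inputs (corolla I) tt -> False by rewrite inE.
split.
  move=> [[x|] xP] [[y|] yP] /=; last 3 first.
  - by case: (noN yP).
  - by case: (noN xP).
  - by case: (noN xP).
  by move/f_inj => xy; apply: val_inj; rewrite /= xy.
rewrite (_ : [set _ | _ in _] = [set (f \o Some) i | i : I]) //.
apply/setP => z; apply/imsetP/imsetP => [[[[x|] xP] _ ->]|[x _ ->]].
- by exists x.
- by case: (noN xP).
have xP : Some x \in @inputs (corolla I) tt by rewrite inE.
by exists (exist (fun x => x \in @inputs (corolla I) tt) (Some x) xP).
Qed.

Definition corolla_map (I : finType) (T : tree) (f : option I -> edge T)
    (fP : tree_op (f \o Some) (f None)) : operad_map (omega (corolla I)) (omega T) :=
  omega_map (corolla_tree_op fP).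

Definition degeneracy : operad_map (omega (corolla unit)) (omega eta) :=
  @corolla_map unit eta (fun=> tt) (@tree_op_unit eta tt).

Definition degenerate (X : dset) (u : X (corolla unit)) : Prop :=
  exists x : X eta, u = pull degeneracy x.

(* The corolla on [I] with a unary vertex grafted on top of its input [i]:
   [Some x] is the edge [x] of the corolla and [None] is the edge i'. *)
Definition graft_top (I : finType) (i : I) : tree.
Proof.
refine (@Tree (option (option I)) bool (Some None)
  (fun v => if v then Some (Some i) else Some None)
  (fun x => match x with
            | None => Some true
            | Some (Some _) => Some false
            | Some None => None
            end) _ _ _).
- by case=> -[].
- by case=> [[]|].
- by case=> [[j|]|]; [exists 1 | exists 0 | exists 2].
Defined.

(* The corolla on [I] with a unary vertex grafted below its output 0:
   [Some x] is the edge [x] of the corolla and [None] is the edge 0'. *)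
Definition graft_bottom (I : finType) : tree.
Proof.
refine (@Tree (option (option I)) bool None
  (fun v => if v then None else Some None)
  (fun x => match x with
            | None => None
            | Some (Some _) => Some false
            | Some None => Some true
            end) _ _ _).
- by case=> -[].
- by case=> [[]|].
- by case=> [[j|]|]; [exists 2 | exists 1 | exists 0].
Defined.

Section HomotopyFaces.
Variables (I : finType).

Definition top_corolla (i : I) : operad_map (omega (corolla I)) (omega (graft_top i)).
Proof.
apply: (@corolla_map I (graft_top i) Some); split; first by move=> x y [].
rewrite (_ : [set _ | _ in _] = @inputs (graft_top i) false).
  exact: (@subtree_vertex (graft_top i) false).
apply/setP => -[[x|]|]; rewrite inE /=.
- by rewrite (imset_f (fun x => Some (Some x))).
- by apply/imsetP => -[].
- by apply/imsetP => -[].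
Defined.

Definition top_unary (i : I) : operad_map (omega (corolla unit)) (omega (graft_top i)).
Proof.
apply: (@corolla_map unit (graft_top i) (fun x => if x is Some _ then None else Some (Some i))).
split; first by move=> [] [].
rewrite (_ : [set _ | _ in _] = @inputs (graft_top i) true).
  exact: (@subtree_vertex (graft_top i) true).
apply/setP => -[[x|]|]; rewrite inE /=.
- by apply/imsetP => -[].
- by apply/imsetP => -[].
- by apply/imsetP; exists tt.
Defined.

Definition top_inner (i : I) : operad_map (omega (corolla I)) (omega (graft_top i)).
Proof.
apply: (@corolla_map I (graft_top i)
  (fun x => if x == Some i then None else Some x)); split.
  by move=> x y /=; case: eqP => [[->]|_]; case: eqP => [[->]|_] // -[].
have -> : [set (if Some x == Some i then None else Some (Some x)) | x : I]
    = (@inputs (graft_top i) false :\ Some (Some i)) :|: @inputs (graft_top i) true.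
  apply/setP => -[[x|]|]; rewrite !inE /=.
  - rewrite orbF andbT; apply/imsetP/idP => [[y _]|xi].
      by case: eqP => // yi [->]; apply/eqP => -[yi']; case: yi; rewrite yi'.
    by exists x => //; case: eqP => // -[xi']; rewrite xi' eqxx in xi.
  - by apply/imsetP => -[y _]; case: eqP.
  - by apply/imsetP; exists i => //; rewrite eqxx.
apply: (@subtree_graft (graft_top i) _ _ true).
  exact: (@subtree_vertex (graft_top i) false).
by rewrite inE.
Defined.

Definition bottom_corolla : operad_map (omega (corolla I)) (omega (graft_bottom I)).
Proof.
apply: (@corolla_map I (graft_bottom I) Some); split; first by move=> x y [].
rewrite (_ : [set _ | _ in _] = @inputs (graft_bottom I) false).
  exact: (@subtree_vertex (graft_bottom I) false).
apply/setP => -[[x|]|]; rewrite inE /=.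
- by rewrite (imset_f (fun x => Some (Some x))).
- by apply/imsetP => -[].
- by apply/imsetP => -[].
Defined.

Definition bottom_unary : operad_map (omega (corolla unit)) (omega (graft_bottom I)).
Proof.
apply: (@corolla_map unit (graft_bottom I) (fun x => if x is Some _ then Some None else None)).
split; first by move=> [] [].
rewrite (_ : [set _ | _ in _] = @inputs (graft_bottom I) true).
  exact: (@subtree_vertex (graft_bottom I) true).
apply/setP => -[[x|]|]; rewrite inE /=.
- by apply/imsetP => -[].
- by apply/imsetP; exists tt.
- by apply/imsetP => -[].
Defined.

Definition bottom_inner : operad_map (omega (corolla I)) (omega (graft_bottom I)).
Proof.
apply: (@corolla_map I (graft_bottom I)
  (fun x => if x is Some j then Some (Some j) else None)); split; first by move=> x y [].
have -> : [set Some (Some x) | x : I]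
    = (@inputs (graft_bottom I) true :\ Some None) :|: @inputs (graft_bottom I) false.
  apply/setP => -[[x|]|]; rewrite !inE /=.
  - by rewrite (imset_f (fun x => Some (Some x))).
  - by apply/imsetP => -[].
  - by apply/imsetP => -[].
apply: (@subtree_graft (graft_bottom I) _ _ false).
  exact: (@subtree_vertex (graft_bottom I) true).
by rewrite inE.
Defined.

End HomotopyFaces.

Definition homotopic_at (X : dset) (I : finType) (o : option I) (f g : X (corolla I)) : Prop :=
  match o with
  | Some i => exists h : X (graft_top i),
      [/\ pull (top_corolla i) h = f, pull (top_inner i) h = g
        & degenerate (pull (top_unary i) h)]
  | None => exists h : X (graft_bottom I),
      [/\ pull (bottom_corolla I) h = f, pull (bottom_inner I) h = g
        & degenerate (pull (bottom_unary I) h)]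
  end.

(* In an inner Kan complex the relations [homotopic_at o] do not depend on [o]. *)
Definition homotopic (X : dset) (I : finType) (f g : X (corolla I)) : Prop :=
  exists o : option I, homotopic_at o f g.

Definition has_boundary (X : dset) (I : finType) (c : I -> X eta) (d : X eta)
    (f : X (corolla I)) : Prop :=
  pull (@edge_map (corolla I) None) f = d /\
  forall i : I, pull (@edge_map (corolla I) (Some i)) f = c i.

(* The homotopy class of [f] is the set of all [g] with [homotopic f g]. *)
Definition Ho (X : dset) (I : finType) (c : I -> X eta) (d : X eta) : Type :=
  {A : X (corolla I) -> Prop | exists2 f, has_boundary c d f & A = homotopic f}.

(* The operad structure of Ho(X) is the unique one on the collection [Ho X] for which
   such a map [q] exists. *)
Definition is_Ho_quotient (X : dset) (H : operad_struct (@Ho X))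
    (q : dmap X (nerve (Operad H))) : Prop :=
  (forall x : X eta, cmap (q eta x) tt = x) /\
  (forall (I : finType) (f : X (corolla I)),
     sval (omap (q (corolla I) f) (corolla_op I)) = homotopic f).

Definition dmap_id (X : dset) : dmap X X := @DMap X X (fun T x => x) (fun S T a x => erefl).

Record nerve_left_adjoint := NerveLeftAdjoint {
  tau :> dset -> operad;
  tau_map : forall X Y : dset, dmap X Y -> operad_map (tau X) (tau Y);
  tau_map_id : forall X : dset, tau_map (dmap_id X) = operad_id (tau X);
  tau_map_comp : forall (X Y Z : dset) (G : dmap Y Z) (F : dmap X Y),
    tau_map (dcomp G F) = operad_comp (tau_map G) (tau_map F);
  transpose : forall (X : dset) (P : operad), operad_map (tau X) P -> dmap X (nerve P);
  adjoint : forall (X : dset) (P : operad), dmap X (nerve P) -> operad_map (tau X) P;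
  transposeK : forall (X : dset) (P : operad), cancel (@transpose X P) (@adjoint X P);
  adjointK : forall (X : dset) (P : operad), cancel (@adjoint X P) (@transpose X P);
  transpose_natl : forall (X Y : dset) (P : operad) (F : dmap X Y) (G : operad_map (tau Y) P),
    transpose (operad_comp G (tau_map F)) = dcomp (transpose G) F;
  transpose_natr : forall (X : dset) (P Q : operad) (F : operad_map (tau X) P)
    (G : operad_map P Q), transpose (operad_comp G F) = dcomp (nerve_map G) (transpose F)
}.

(* Main.v *)
(* The quotient map q : X -> N(Ho X) is the universal map from X to the nerve of an
   operad, which by the Yoneda lemma is the claim. Given phi : X -> N(P), two homotopic
   operations have the same value in P, because one is the other composed with a unit;
   so phi descends to the classes, that is, to the operations of Ho X. The extension
   preserves composition because in an inner Kan complex any two composable f and g are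
   the outer faces of a dendrex h on the grafted corollas, and both q and phi send the
   inner face of h to the composite of the values of f and g. Finally, operad maps out
   of the free operad of a tree are determined by their values on edges and vertices,
   so phi is recovered from its restriction to corollas. *)

From mathcomp Require Import all_boot.
From mathcomp Require Import boolp.
Require Import Defs.

Set Implicit Arguments.
Unset Strict Implicit.
Unset Printing Implicit Defensive.

(** * Operations bundled with their colours *)

(* Bundling the colours with the operation turns equalities between operations whose
   colourings agree only propositionally into plain equalities. *)
Record any_op (P : operad) (I : finType) := AnyOp {
  any_in : I -> colour P;
  any_out : colour P;
  any_val : op any_in any_out
}.

Arguments AnyOp {P I any_in any_out} any_val.

Section AnyOp.
Variable P : operad.

(** Recovering an operation from its bundled form is a transport along equalities of colours, which
    does not depend on the proofs of these equalities. *)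
Lemma AnyOp_inj (I : finType) (c : I -> colour P) (d : colour P) (p q : op c d) :
  AnyOp p = AnyOp q -> p = q.
Proof.
pose t (a : any_op P I) (ec : any_in a = c) (ed : any_out a = d) : op c d :=
  eq_rect _ (fun d => op c d) (eq_rect _ (fun c => op c _) (any_val a) _ ec) _ ed.
have tE (a b : any_op P I) ec ed ec' ed' : a = b -> t a ec ed = t b ec' ed'.
  by move=> ab; case: _ / ab ec' ed' => *; congr t; apply: Prop_irrelevance.
exact: (tE (AnyOp p) (AnyOp q) erefl erefl erefl erefl).
Qed.

Lemma any_op_ex (I : finType) (a : any_op P I) (c : I -> colour P) (d : colour P) :
  any_in a =1 c -> any_out a = d -> exists p : op c d, AnyOp p = a.
Proof. by case: a => c' d' p /= /funext ec ed; case: _ / ec; case: _ / ed; exists p. Qed.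

Definition any_act (I J : finType) (s : J -> I) (s_bij : bijective s) (a : any_op P I) :
    any_op P J :=
  AnyOp (act P s_bij (fun=> erefl : any_in a (s _) = _) (any_val a)).

Lemma any_actE (I J : finType) (c : I -> colour P) (c' : J -> colour P) (d : colour P)
    (s : J -> I) (s_bij : bijective s) (ec : c' =1 c \o s) (p : op c d) :
  AnyOp (act P s_bij ec p) = any_act s_bij (AnyOp p).
Proof.
have e := funext ec; rewrite /any_act /=; move: ec; rewrite e => ec.
by congr (AnyOp (act _ _ _ _)); apply: Prop_irrelevance.
Qed.

Definition any_comp (I J : finType) (i : I) (a : any_op P I) (b : any_op P J)
    (e : any_out b = any_in a i) : any_op P (splice J i) :=
  AnyOp (comp P e (any_val a) (any_val b)).

Lemma any_comp_eq (I J : finType) (i : I) (a a' : any_op P I) (b b' : any_op P J) e e' :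
  a = a' -> b = b' ->
  any_comp (i := i) (a := a) (b := b) e = any_comp (i := i) (a := a') (b := b') e'.
Proof.
move=> ea eb; case: _ / ea e'; case: _ / eb => e'.
by congr any_comp; apply: Prop_irrelevance.
Qed.

Lemma any_act_id (I : finType) (bij : bijective id) (a : any_op P I) : any_act bij a = a.
Proof. by case: a => c d p; rewrite /any_act act_id. Qed.

Lemma any_comp_unitl (I : finType) (b : any_op P I) e :
  any_act (splice_unitl_bij I)
    (any_comp (i := tt) (a := AnyOp (unit_op P (any_out b))) (b := b) e) = b.
Proof.
case: b e => c d p /= e; rewrite (Prop_irrelevance e erefl).
have ec : c =1 splice_col (i := tt) (fun=> d) c \o inr by [].
apply: etrans (esym (any_actE _ ec _)) _.
by congr AnyOp; exact: comp_unitl.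
Qed.

Lemma any_comp_unitr (I : finType) (i : I) (a : any_op P I) e :
  any_act (splice_unit_bij i)
    (any_comp (i := i) (a := a) (b := AnyOp (unit_op P (any_in a i))) e) = a.
Proof.
case: a e => c d p /= e; rewrite (Prop_irrelevance e erefl).
have ec : c =1 splice_col c (fun=> c i) \o splice_unit i.
  by move=> x; rewrite /= /splice_unit; case: insubP => [y _ <-//|/negPn/eqP ->].
apply: etrans (esym (any_actE _ ec _)) _.
by congr AnyOp; exact: comp_unitr.
Qed.

End AnyOp.

Arguments any_comp {P I J} i a b e.

Section AnyMap.
Variables (P Q : operad) (F : operad_map P Q).

Definition any_map (I : finType) (a : any_op P I) : any_op Q I := AnyOp (omap F (any_val a)).

Lemma any_map_act (I J : finType) (s : J -> I) (s_bij : bijective s) (a : any_op P I) :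
  any_map (any_act s_bij a) = any_act s_bij (any_map a).
Proof. by rewrite /any_map /= (omap_act F s_bij _ (fun=> erefl)) any_actE. Qed.

Lemma any_map_comp (I J : finType) (i : I) (a : any_op P I) (b : any_op P J) e e' :
  any_map (any_comp i a b e) = any_comp i (any_map a) (any_map b) e'.
Proof.
have bij : bijective (@id (splice J i)) by exists id.
have ec : cmap F \o splice_col (any_in a) (any_in b) =1
   splice_col (i := i) (cmap F \o any_in a) (cmap F \o any_in b) \o id by case.
by rewrite /any_map /= (omap_comp F e e' bij ec) any_actE any_act_id.
Qed.

End AnyMap.

Arguments any_map_comp {P Q} F {I J i a b} e e'.

(** Operations of a tree operad live in [Prop], so their colours determine them. This identifies
    faces of trees with composites and relabellings. *)
Lemma omega_any_op_eq (T : tree) (I : finType) (a b : any_op (omega T) I) :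
  any_in a =1 any_in b -> any_out a = any_out b -> a = b.
Proof.
case: a b => c d p [c' d' p'] /= /funext ec ed; case: _ / ec p'; case: _ / ed => p'.
by congr AnyOp; exact: omega_thin.
Qed.

(** The uniqueness half of [omega_free], bundled so that no transport along an equality of colour
    maps remains. *)
Lemma omega_any_map_eq (T : tree) (P : operad) (F G : operad_map (omega T) P) :
  cmap F =1 cmap G ->
  (forall v, any_map F (AnyOp (vertex_op v)) = any_map G (AnyOp (vertex_op v))) -> F = G.
Proof.
move=> /funext eFG FG; have [K [_ K_uniq]] := omega_free (fun v => omap G (vertex_op v)).
rewrite -(K_uniq G); last by exists erefl.
apply/esym/K_uniq; exists eFG => v; apply: AnyOp_inj; apply: etrans (FG v).
by rewrite /any_map; move: (cmap G) eFG => h; case: _ /.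
Qed.

Definition op_map (T : tree) (I : finType) (c : I -> edge T) (e : edge T)
    (ce : tree_op c e) : operad_map (omega (corolla I)) (omega T) :=
  @corolla_map I T (fun o => if o is Some i then c i else e) ce.

Lemma any_map_op_map (T : tree) (I : finType) (c : I -> edge T) (e : edge T)
    (ce : tree_op c e) :
  any_map (op_map ce) (AnyOp (corolla_op I)) = AnyOp (ce : @op (omega T) I c e).
Proof. exact: omega_any_op_eq. Qed.

(** * Values of a map into a nerve on colours and corollas *)

Section Value.
Variables (X : dset) (P : operad) (phi : dmap X (nerve P)).

Definition col_val (x : X eta) : colour P := cmap (phi eta x) tt.

Definition val_op (I : finType) (f : X (corolla I)) : any_op P I :=
  any_map (phi (corolla I) f) (AnyOp (corolla_op I)).

Lemma cmap_val (T : tree) (x : X T) (y : edge T) :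
  cmap (phi T x) y = col_val (pull (edge_map y) x).
Proof. by rewrite /col_val dapp_pull. Qed.

Lemma val_op_pull (T : tree) (I : finType) (b : operad_map (omega (corolla I)) (omega T))
    (x : X T) :
  val_op (pull b x) = any_map (phi T x) (any_map b (AnyOp (corolla_op I))).
Proof. by rewrite /val_op dapp_pull. Qed.

Lemma val_op_degeneracy (x : X eta) : val_op (pull degeneracy x) = AnyOp (unit_op P (col_val x)).
Proof.
rewrite val_op_pull (_ : any_map _ _ = AnyOp (unit_op (omega eta) tt)).
  by rewrite /any_map /= omap_unit.
exact: omega_any_op_eq.
Qed.

Lemma val_op_in (I : finType) (f : X (corolla I)) (i : I) :
  any_in (val_op f) i = col_val (pull (@edge_map (corolla I) (Some i)) f).
Proof. exact: cmap_val. Qed.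

Lemma val_op_out (I : finType) (f : X (corolla I)) :
  any_out (val_op f) = col_val (pull (@edge_map (corolla I) None) f).
Proof. exact: cmap_val. Qed.

(** In the operad of the two-vertex tree the inner face is the composite of the corolla face with
    the unary operation. A degenerate unary dendrex is sent to a unit, so the two unit laws give the
    two cases. *)
Lemma val_op_homotopic (I : finType) (f g : X (corolla I)) :
  homotopic f g -> val_op f = val_op g.
Proof.
case=> -[i|] [h [<- <- [x hx]]].
- have hu : val_op (pull (top_unary i) h) = AnyOp (unit_op P (col_val x)).
    by rewrite hx val_op_degeneracy.
  rewrite !val_op_pull in hu *.
  set F := phi _ h in hu *; set a := any_map (top_corolla i) _.
  set u := any_map (top_unary i) _ in hu.
  have e : any_out u = any_in a i by [].
  (* [splice_unit i] gives the label [i] to the input i' of the composite. *)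
  have -> : any_map (top_inner i) (AnyOp (corolla_op I)) =
      any_act (splice_unit_bij i) (any_comp i a u e).
    apply: omega_any_op_eq => // j; rewrite /= /splice_unit.
    case: insubP => [y ji yj|/negPn/eqP ->]; last by rewrite /= eqxx.
    by rewrite /= yj (inj_eq (@Some_inj _)) (negPf ji).
  have e' : any_out (any_map F u) = any_in (any_map F a) i by [].
  rewrite any_map_act (any_map_comp F e e').
  rewrite -[LHS](any_comp_unitr (i := i) (a := any_map F a) erefl); congr any_act.
  apply: any_comp_eq => //; rewrite hu.
  by have -> : any_in (any_map F a) i = col_val x by rewrite -e' hu.
- have hu : val_op (pull (bottom_unary I) h) = AnyOp (unit_op P (col_val x)).
    by rewrite hx val_op_degeneracy.
  rewrite !val_op_pull in hu *.
  set F := phi _ h in hu *; set a := any_map (bottom_corolla I) _.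
  set u := any_map (bottom_unary I) _ in hu.
  have e : any_out a = any_in u tt by [].
  have -> : any_map (bottom_inner I) (AnyOp (corolla_op I)) =
      any_act (splice_unitl_bij I) (any_comp tt u a e) by exact: omega_any_op_eq.
  have e' : any_out (any_map F a) = any_in (any_map F u) tt by [].
  rewrite any_map_act (any_map_comp F e e').
  rewrite -[LHS](any_comp_unitl (b := any_map F a) erefl); congr any_act.
  apply: any_comp_eq => //; rewrite hu.
  have -> // : any_out (any_map F a) = col_val x.
  by rewrite e' hu.
Qed.

End Value.

(** * Operations of trees and reflexivity of homotopy *)

(** The hypotheses force [I] to have exactly one element; used to collapse a tree onto a single
    edge. *)
Lemma tree_op_const (T : tree) (e : edge T) (I : finType) (c : I -> edge T) :
  tree_op c e -> (forall A, subtree e A -> A = [set e]) -> tree_op (fun _ : I => tt : edge eta) tt.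
Proof.
case=> c_inj ce leaf; have cE i : c i = e by apply/set1P; rewrite -(leaf _ ce) imset_f.
split; first by move=> i j _; apply: c_inj; rewrite !cE.
have /imsetP[i _ _] : e \in [set c i | i : I] by rewrite (leaf _ ce) set11.
rewrite (_ : [set _ | _ in _] = [set tt]); first exact: (@subtree_edge eta tt).
by apply/setP => -[]; rewrite !inE; apply/imsetP; exists i.
Qed.

Lemma tree_op_inputs (T : tree) (I : finType) (c : I -> edge T) (v : vertex T) :
  injective c -> (forall x, dest x == Some v <-> exists i, c i = x) -> tree_op c (out v).
Proof.
move=> c_inj cv; split=> //; rewrite (_ : [set _ | _ in _] = inputs v).
  exact: subtree_vertex.
apply/setP => x; rewrite inE; apply/imsetP/idP => [[i _ ->]|/cv[i <-]]; last by exists i.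
by apply/cv; exists i.
Qed.

(** Lets the vertex condition of [omega_map] be checked on a convenient enumeration of the
    inputs. *)
Lemma tree_op_reindex (S T : tree) (f : edge S -> edge T) (v : vertex S) (I : finType)
    (c : I -> edge S) (e : edge T) :
  injective c -> (forall x, dest x == Some v <-> exists i, c i = x) ->
  tree_op (f \o c) e -> tree_op (fun x : {x | x \in inputs v} => f (val x)) e.
Proof.
move=> c_inj cv; have cin i : c i \in inputs v by rewrite inE; apply/cv; exists i.
have ex (x : {x | x \in inputs v}) : {i | c i = val x}.
  by apply: cid; apply/cv; have := valP x; rewrite inE.
apply: (@tree_op_act _ _ _ _ _ _ (fun x => sval (ex x))) => [|x]; last first.
  by rewrite /= (svalP (ex x)).
exists (fun i => exist (fun x => x \in inputs v) (c i) (cin i)) => [x|i].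
  by apply: val_inj; rewrite /= (svalP (ex x)).
by apply: c_inj; rewrite (svalP (ex _)).
Qed.

(** The constant homotopy: [f] is pulled back along the map that collapses the unary vertex onto the
    output edge of the corolla. *)
Lemma homotopic_refl (X : dset) (I : finType) (f : X (corolla I)) : homotopic f f.
Proof.
(* [obind id] sends both 0 and 0' to the output and each input to itself. *)
have sP (v : vertex (graft_bottom I)) : tree_op
    (fun x : {x | x \in inputs v} => obind id (val x) : edge (corolla I)) (obind id (out v)).
  case: v => /=.
    apply: (@tree_op_reindex (graft_bottom I) (corolla I) (obind id) true unit (fun=> Some None)).
    - by do 2!case.
    - by move=> [[x|]|]; split=> //; try (by case); exists tt.
    - exact: (@tree_op_unit (corolla I) None).
  apply: (@tree_op_reindex (graft_bottom I) (corolla I) (obind id) false I (Some \o Some)).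
  - by move=> x y [].
  - by move=> [[x|]|]; split=> //; try (by case); exists x.
  - exact: corolla_op.
pose s := omega_map sP; exists None, (pull s f); split.
- by rewrite -pull_comp -[RHS]pull_id; congr pull; apply: omega_map_eq; case.
- by rewrite -pull_comp -[RHS]pull_id; congr pull; apply: omega_map_eq; case.
- exists (pull (@edge_map (corolla I) None) f).
  by rewrite -!pull_comp; congr pull; apply: omega_map_eq; case.
Qed.

(** * Two grafted corollas and their inner horn *)

Section Graft.
Variables (I J : finType) (i : I).

(* [inl x] is the edge [x] of the bottom corolla, [inr j] the input [j] of the top
   one; the edge [inl (Some i)] joins them. The vertex [true] is the top one. *)
Definition graft : tree.
Proof.
refine (@Tree (option I + J)%type bool (inl None)
  (fun v => if v then inl (Some i) else inl None)
  (fun x => match x with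
            | inl None => None
            | inl (Some _) => Some false
            | inr _ => Some true
            end) _ _ _).
- by case=> -[].
- by case=> [[]|].
- by case=> [[j|]|j]; [exists 1 | exists 0 | exists 2].
Defined.

Definition graft_edge : edge graft := inl (Some i).

Lemma graft_bot_dest (x : edge graft) :
  dest x == Some false <-> exists y : I, inl (Some y) = x.
Proof. by case: x => [[x|]|x]; split=> //; [exists x | case | case]. Qed.

Lemma graft_top_dest (x : edge graft) : dest x == Some true <-> exists y : J, inr y = x.
Proof. by case: x => [[x|]|x]; split=> //; [case | case | exists x]. Qed.

Lemma graft_bot_op : tree_op (fun x : I => inl (Some x) : edge graft) (inl None).
Proof. by apply: (tree_op_inputs _ graft_bot_dest) => x y []. Qed.

Lemma graft_top_op : tree_op (fun x : J => inr x : edge graft) graft_edge.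
Proof. by apply: (tree_op_inputs _ graft_top_dest) => x y []. Qed.

Definition graft_bot_map : operad_map (omega (corolla I)) (omega graft) := op_map graft_bot_op.

Definition graft_top_map : operad_map (omega (corolla J)) (omega graft) := op_map graft_top_op.

Definition graft_inner_map : operad_map (omega (corolla (splice J i))) (omega graft) :=
  op_map (tree_op_comp (i := i) erefl graft_bot_op graft_top_op).

Lemma graft_inner : inner graft_edge.
Proof. by rewrite /inner /= andbT; apply/codomP; exists true. Qed.

Lemma graft_inner_edge (x : edge graft) : inner x -> x = graft_edge.
Proof. by case: x => [[x|]|x] /andP[/codomP[[] //= ->]]. Qed.

Lemma graft_outer (v : vertex graft) : outer_vertex v.
Proof.
apply/cards1P; exists graft_edge; apply/setP => x; rewrite !inE.
apply/idP/eqP => [/andP[_]|->]; first exact: graft_inner_edge.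
by rewrite graft_inner andbT; case: v; rewrite ?eqxx ?orbT.
Qed.

(** The joining edge is the only inner edge and every edge is attached to one of the two vertices,
    so deleting [w] leaves the corolla at [v]. *)
Lemma graft_kept (v w : vertex graft) (x : edge graft) :
  w != v -> kept w x = (x == out v) || (dest x == Some v).
Proof.
move=> wv; rewrite /kept negb_and negbK orbC.
have -> : inner x = (x == graft_edge).
  by apply/idP/eqP => [|->]; [exact: graft_inner_edge | exact: graft_inner].
by rewrite !inE; case: v w wv => -[] //= _; case: x => [[x|]|x] //=;
  rewrite ?orbT ?orbF ?orbN.
Qed.

(** Replaces a pruned tree by an explicit corolla in the description of the horn: two maps that
    factor through each other generate the same part of the representable. *)
Lemma graft_face (v w : vertex graft) (hw : outer_vertex w) (U : finType)
    (c : U -> edge graft) (c_op : tree_op c (out v)) :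
  w != v -> injective c -> (forall x, dest x == Some v <-> exists u, c u = x) ->
  (exists b, op_map c_op = operad_comp (outer_face hw) b) /\
  (exists b, outer_face hw = operad_comp (op_map c_op) b).
Proof.
move=> wv c_inj cv; have cd u : dest (c u) == Some v by apply/cv; exists u.
have ck u : kept w (c u) by rewrite (graft_kept _ wv) cd orbT.
have vk : kept w (out v) by rewrite (graft_kept _ wv) eqxx.
have vw : v != w by rewrite eq_sym.
pose c' u : edge (prune hw) := exist (kept w) (c u) (ck u).
pose v' : vertex (prune hw) := exist (fun u => u != w) v vw.
have c'_inj : injective c' by move=> x y [/c_inj].
have c'v x : dest x == Some v' <-> exists u, c' u = x.
  have -> : (dest x == Some v') = (dest (val x) == Some v).
    rewrite -[dest x]/(prune_dest x) /prune_dest; case: (@dest graft (val x)) => //= u.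
    case: insubP => [u' _ <-|] //=.
    by rewrite negbK => /eqP ->; rewrite (inj_eq (@Some_inj _)) (negPf wv).
  split=> [/cv[u ux]|[u <-]]; last exact: cd.
  by exists u; apply: val_inj.
have c'_op : tree_op c' (out v') by exact: tree_op_inputs.
split.
  by exists (op_map c'_op); apply: omega_map_eq; case.
(* The inverse on edges: an input of [v] goes to its index, and the one remaining edge, the output
   of [v], to the default [None]. *)
pose g (x : edge (prune hw)) : edge (corolla U) := [pick u | c u == val x].
have gP (u : vertex (prune hw)) :
    tree_op (fun x : {x | x \in inputs u} => g (val x)) (g (out u)).
  have boolE (x y z : bool) : x != z -> z != y -> x = y by case: x y z => -[] [].
  have -> : u = v' by apply: val_inj; exact: boolE (valP u) wv.
  have -> : g (out v') = None.
    rewrite /g; case: pickP => // x /eqP /= xv.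
    by have := @input_neq graft (c x) v; rewrite inE cd xv eqxx => /(_ isT).
  apply: (tree_op_reindex c'_inj c'v); have -> : g \o c' = Some; last exact: corolla_op.
  apply: funext => x; rewrite /g /=; case: pickP => [y /eqP/c_inj -> //|/(_ x)].
  by rewrite eqxx.
exists (omega_map gP); apply: omega_map_eq => x /=; rewrite /g.
case: pickP => [u /eqP <- //|no_u]; have := valP x; rewrite (graft_kept _ wv) /= => /orP[/eqP //|].
by move=> /cv[u ux]; have := no_u u; rewrite ux eqxx.
Qed.

(** There is only one inner face, and a tree with two vertices has no edge faces; the two outer
    faces are the corollas by [graft_face]. *)
Lemma graft_horn (S : tree) (a : operad_map (omega S) (omega graft)) :
  @in_horn graft graft_edge S a <->
  (exists b, a = operad_comp graft_bot_map b) \/ (exists b, a = operad_comp graft_top_map b).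
Proof.
have [bot_in bot_out] := @graft_face false true (graft_outer true) _ _ graft_bot_op
  isT (fun x y => @Some_inj _ x y \o @inl_inj _ _ _ _) graft_bot_dest.
have [top_in top_out] := @graft_face true false (graft_outer false) _ _ graft_top_op
  isT (@inr_inj _ _) graft_top_dest.
split=> [[[e' he|[] v_out|x hx]]|].
- by move=> /= /negP[]; rewrite (graft_inner_edge he).
- rewrite (Prop_irrelevance v_out (graft_outer true)) => _ [b ->].
  left; case: bot_out => b' bE; exists (operad_comp b' b).
  by rewrite -operad_compA [X in operad_comp X b]bE.
- rewrite (Prop_irrelevance v_out (graft_outer false)) => _ [b ->].
  right; case: top_out => b' bE; exists (operad_comp b' b).
  by rewrite -operad_compA [X in operad_comp X b]bE.
- by exfalso; move: hx; rewrite card_bool.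
- case=> -[b ->].
  + exists (OuterFace (graft_outer true)) => //; case: bot_in => b' bE.
    by exists (operad_comp b' b); rewrite /graft_bot_map bE operad_compA.
  + exists (OuterFace (graft_outer false)) => //; case: top_in => b' bE.
    by exists (operad_comp b' b); rewrite /graft_top_map bE operad_compA.
Qed.

End Graft.

Arguments graft_top_map {I J} i.
Arguments graft_bot_map {I} J i.
Arguments graft_inner_map {I} J i.

(** * Filling the horn of two grafted corollas *)

Lemma corolla_leaf_subtree (I : finType) (i : I) (A : {set edge (corolla I)}) :
  @subtree (corolla I) (Some i) A -> A = [set Some i].
Proof. by elim=> // {}A v _ -> ; rewrite inE. Qed.

(* The two faces of [graft] meet only in the edge joining the corollas; a tree mapped
   into both of them is sent to the identity operation of that edge. *)
Lemma graft_overlap (I J : finType) (i : I) (S : tree)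
    (b : operad_map (omega S) (omega (corolla I)))
    (b' : operad_map (omega S) (omega (corolla J))) :
  operad_comp (graft_bot_map J i) b = operad_comp (graft_top_map i) b' ->
  exists t : operad_map (omega S) (omega eta),
    b = operad_comp (@edge_map (corolla I) (Some i)) t /\
    b' = operad_comp (@edge_map (corolla J) None) t.
Proof.
move=> bb'; have {bb'} bb' x := congr1 (fun F => cmap F x) bb'.
have bE x : cmap b x = Some i.
  by have := bb' x; rewrite /=; case: (cmap b x) (cmap b' x) => [y|] [z|] //= [->].
have b'E x : cmap b' x = None.
  by have := bb' x; rewrite /=; case: (cmap b x) (cmap b' x) => [y|] [z|].
have tP (v : vertex S) : tree_op (fun _ : {x | x \in inputs v} => tt : edge eta) tt.
  apply: (tree_op_const (omap b (vertex_op v))) => A; rewrite bE.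
  exact: corolla_leaf_subtree.
by exists (@omega_map S eta (fun=> tt) tP); split; apply: omega_map_eq => x /=; rewrite ?bE ?b'E.
Qed.

Lemma graft_bot_inj (I J : finType) (i : I) (S : tree)
    (b b' : operad_map (omega S) (omega (corolla I))) :
  operad_comp (graft_bot_map J i) b = operad_comp (graft_bot_map J i) b' -> b = b'.
Proof.
move=> bb'; apply: omega_map_eq => x; move: (congr1 (fun F => cmap F x) bb') => /=.
by case: (cmap b x) (cmap b' x) => [y|] [z|] // [->].
Qed.

Lemma graft_top_inj (I J : finType) (i : I) (S : tree)
    (b b' : operad_map (omega S) (omega (corolla J))) :
  operad_comp (graft_top_map i) b = operad_comp (graft_top_map i) b' -> b = b'.
Proof.
move=> bb'; apply: omega_map_eq => x; move: (congr1 (fun F => cmap F x) bb') => /=.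
by case: (cmap b x) (cmap b' x) => [y|] [z|] // [->].
Qed.

(** The horn consists of two corollas glued along the joining edge, so [f] and [g] with equal
    colours there define a map out of it, which the Kan condition extends. *)
Lemma graft_filler (X : dset) (I J : finType) (i : I) (f : X (corolla I)) (g : X (corolla J)) :
  inner_kan X ->
  pull (@edge_map (corolla I) (Some i)) f = pull (@edge_map (corolla J) None) g ->
  exists h : X (graft J i), pull (graft_bot_map J i) h = f /\ pull (graft_top_map i) h = g.
Proof.
move=> X_kan fg.
(* The graph of the horn map: single-valued by [graft_overlap] and injectivity of the two faces,
   total on the horn by [graft_horn]. *)
pose R (S : tree) (a : operad_map (omega S) (omega (graft J i))) (w : X S) :=
  (exists2 b, a = operad_comp (graft_bot_map J i) b & w = pull b f) \/
  (exists2 b, a = operad_comp (graft_top_map i) b & w = pull b g).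
have R_uniq S a (w w' : X S) : R S a w -> R S a w' -> w = w'.
  have overlap b b' : operad_comp (graft_bot_map J i) b = operad_comp (graft_top_map i) b' ->
      pull b f = pull b' g.
    by case/graft_overlap => t [-> ->]; rewrite !pull_comp fg.
  case=> -[b -> ->] [] [b' bb' ->].
  - by rewrite (graft_bot_inj bb').
  - exact: overlap.
  - exact/esym/overlap/esym.
  - by rewrite (graft_top_inj bb').
have R_ex S (a : horn (graft_edge J i) S) : exists w, R S (sval a) w.
  case: a => a /= /graft_horn[[b ->]|[b ->]].
    by exists (pull b f); left; exists b.
  by exists (pull b g); right; exists b.
have R_pull S S' (c : operad_map (omega S') (omega S)) a w :
    R S a w -> R S' (operad_comp a c) (pull c w).
  case=> -[b -> ->]; [left | right]; exists (operad_comp b c);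
    by rewrite ?operad_compA ?pull_comp.
pose F S a := sval (cid (R_ex S a)); have FP S a : R S (sval a) (F S a) by exact: svalP.
have F_pull S' S (c : operad_map (omega S') (omega S)) (a : horn (graft_edge J i) S) :
    F S' (pull c a) = pull c (F S a).
  by apply: R_uniq (FP _ _) _; exact: R_pull.
have [G GF] := X_kan _ _ (graft_inner J i) (DMap F_pull).
(* By the Yoneda lemma [G] is given by its value at the identity; pulling this back along an element
   of the horn returns the value of the horn map. *)
exists (G _ (operad_id _)).
have GR S (c : operad_map (omega S) (omega (graft J i))) w :
    R S c w -> pull c (G _ (operad_id _)) = w.
  move=> cw; have c_horn : @in_horn (graft J i) (graft_edge J i) S c.
    by apply/graft_horn; case: cw => -[b -> _]; [left | right]; exists b.
  rewrite -dapp_pull; have -> : pull c (operad_id _ : representable (graft J i) _) = c.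
    by apply: omega_map_eq.
  have := congr1 (fun K => dapp K (exist _ c c_horn : horn (graft_edge J i) S)) GF.
  move=> /= ->; apply: R_uniq cw; exact: (FP S (exist _ c c_horn)).
split; apply: GR; [left | right]; exists (operad_id _); by rewrite ?operad_comp1 ?pull_id.
Qed.

(** * The universal property of the quotient map *)

Section Universal.
Variables (X : dset) (X_kan : inner_kan X).
Variables (H : operad_struct (@Ho X)) (q : dmap X (nerve (Operad H))).
Hypothesis q_quotient : is_Ho_quotient q.
Let HoX := Operad H.

Lemma col_val_quotient (x : X eta) : col_val q x = x.
Proof. exact: q_quotient.1. Qed.

Lemma Ho_any_op_eq (I : finType) (a b : any_op HoX I) :
  any_in a =1 any_in b -> any_out a = any_out b -> sval (any_val a) = sval (any_val b) -> a = b.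
Proof.
case: a b => c d p [c' d' p'] /= /funext ec ed; case: _ / ec p'; case: _ / ed => p' pp'.
by congr AnyOp; case: p p' pp' => A A_ex [A' A'_ex] /= AA'; exact: eq_exist.
Qed.

Lemma val_op_quotient_surj (I : finType) (a : any_op HoX I) :
  exists f : X (corolla I), val_op q f = a.
Proof.
case: a => c d [A A_ex]; have [f [f_out f_in] fA] := A_ex; exists f.
apply: Ho_any_op_eq => [i||].
- by rewrite val_op_in col_val_quotient f_in.
- by rewrite val_op_out col_val_quotient f_out.
- by rewrite /= fA; exact: q_quotient.2.
Qed.

Section Extension.
Variables (P : operad) (phi : dmap X (nerve P)).

(** Equal values under [q] mean equal homotopy classes, and reflexivity of homotopy then puts [g]
    into the class of [f]. *)
Lemma val_op_factor (I : finType) (f g : X (corolla I)) :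
  val_op q f = val_op q g -> val_op phi f = val_op phi g.
Proof.
move=> fg; apply: val_op_homotopic.
have sE (h : X (corolla I)) : sval (any_val (val_op q h)) = homotopic h by exact: q_quotient.2.
by rewrite -sE fg sE; exact: homotopic_refl.
Qed.

(** Quantifying over all representatives [f] of [p] makes the operation later chosen here
    independent of the representative. *)
Lemma ext_op_ex (I : finType) (c : I -> X eta) (d : X eta) (p : Ho c d) :
  exists r : @op P I (col_val phi \o c) (col_val phi d),
    forall f, val_op q f = AnyOp (p : @op HoX I c d) -> AnyOp r = val_op phi f.
Proof.
have [f fp] := val_op_quotient_surj (AnyOp (p : @op HoX I c d)).
have [i||r rf] := @any_op_ex _ _ (val_op phi f) (col_val phi \o c) (col_val phi d).
- by rewrite val_op_in -(col_val_quotient (pull _ f)) -val_op_in fp.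
- by rewrite val_op_out -(col_val_quotient (pull _ f)) -val_op_out fp.
exists r => g gp; rewrite rf; apply: val_op_factor; by rewrite fp gp.
Qed.

Definition ext_op (I : finType) (c : I -> X eta) (d : X eta) (p : Ho c d) :
  @op P I (col_val phi \o c) (col_val phi d) := sval (cid (ext_op_ex p)).

Lemma ext_opE (I : finType) (f : X (corolla I)) c d (p : @op HoX I c d) :
  val_op q f = AnyOp p -> AnyOp (ext_op p) = val_op phi f.
Proof. by rewrite /ext_op; case: cid => /= r rP fp; exact: rP. Qed.

Lemma ext_op_unit (x : X eta) : ext_op (unit_op HoX x) = unit_op P (col_val phi x).
Proof.
apply: AnyOp_inj; rewrite -val_op_degeneracy; apply: ext_opE.
by rewrite val_op_degeneracy col_val_quotient.
Qed.

Lemma val_op_act (Q : operad) (psi : dmap X (nerve Q)) (I J : finType) (s : J -> I)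
    (s_bij : bijective s) (e : tree_op (Some \o s : J -> edge (corolla I)) None)
    (f : X (corolla I)) :
  val_op psi (pull (op_map e) f) = any_act s_bij (val_op psi f).
Proof.
by rewrite val_op_pull /val_op -any_map_act; congr any_map; apply: omega_any_op_eq.
Qed.

Lemma ext_op_act (I J : finType) (c : I -> X eta) (c' : J -> X eta) (d : X eta) (s : J -> I)
    (s_bij : bijective s) (ec : c' =1 c \o s)
    (ec' : col_val phi \o c' =1 (col_val phi \o c) \o s) (p : @op HoX I c d) :
  ext_op (act HoX s_bij ec p) = act P s_bij ec' (ext_op p).
Proof.
have [f fp] := val_op_quotient_surj (AnyOp p).
have sP : tree_op (Some \o s : J -> edge (corolla I)) None.
  exact: (tree_op_act s_bij (fun=> erefl) (corolla_op I)).
apply: AnyOp_inj; rewrite any_actE (ext_opE fp) -(val_op_act phi s_bij sP).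
by apply: ext_opE; rewrite any_actE -fp val_op_act.
Qed.

(** In the operad of the grafted tree the inner face is the composite of the two outer faces. The
    operad is arbitrary because both [q] and [phi] take the role of [psi]. *)
Lemma val_op_graft (Q : operad) (psi : dmap X (nerve Q)) (I J : finType) (i : I)
    (h : X (graft J i)) e :
  val_op psi (pull (graft_inner_map J i) h) =
    any_comp i (val_op psi (pull (graft_bot_map J i) h))
      (val_op psi (pull (graft_top_map i) h)) e.
Proof.
move: e; rewrite !val_op_pull => e; rewrite -any_map_comp; congr any_map.
exact: omega_any_op_eq.
Qed.

(** The Kan condition enters here: representatives of [p] and [r] span a horn, and the inner face of
    a filler computes the composite in [HoX] and in [P] at once. *)
Lemma ext_op_comp (I J : finType) (c : I -> X eta) (b : J -> X eta) (d e : X eta) (i : I)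
    (ei : e = c i) (ei' : col_val phi e = col_val phi (c i)) (id_bij : bijective id)
    (ec : col_val phi \o splice_col c b =1
            splice_col (i := i) (col_val phi \o c) (col_val phi \o b) \o id)
    (p : @op HoX I c d) (r : @op HoX J b e) :
  ext_op (comp HoX ei p r) =
    act P id_bij ec (comp P (c := col_val phi \o c) (i := i) ei' (ext_op p) (ext_op r)).
Proof.
have [f fp] := val_op_quotient_surj (AnyOp p).
have [g gr] := val_op_quotient_surj (AnyOp r).
(* Since [q] is the identity on colours, the boundaries of [f] and [g] can be read off from [p] and
   [r]. *)
have fg : pull (@edge_map (corolla I) (Some i)) f = pull (@edge_map (corolla J) None) g.
  by rewrite -[LHS]col_val_quotient -[RHS]col_val_quotient -val_op_in -val_op_out fp gr.
have [h [hf hg]] := graft_filler X_kan fg.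
have hfg (Q : operad) (psi : dmap X (nerve Q)) (u : any_op Q I) (v : any_op Q J) e' :
    val_op psi f = u -> val_op psi g = v ->
    val_op psi (pull (graft_inner_map J i) h) = any_comp i u v e'.
  by move=> fu gv; case: _ / fu e'; case: _ / gv; rewrite -hf -hg; exact: val_op_graft.
apply: AnyOp_inj; rewrite any_actE any_act_id.
rewrite (ext_opE (hfg _ q (AnyOp p) (AnyOp r) ei fp gr)).
exact: (hfg _ phi (AnyOp (ext_op p)) (AnyOp (ext_op r)) ei'
  (esym (ext_opE fp)) (esym (ext_opE gr))).
Qed.

Definition extension : operad_map HoX P :=
  @OperadMap HoX P (col_val phi) ext_op ext_op_unit ext_op_act ext_op_comp.

Lemma extension_val (I : finType) (f : X (corolla I)) :
  any_map extension (val_op q f) = val_op phi f.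
Proof. exact: ext_opE. Qed.

End Extension.

Lemma dmap_eq (Y Z : dset) (F G : dmap Y Z) : (forall T x, F T x = G T x) -> F = G.
Proof.
case: F G => [F F_pull] [G G_pull] /= FG.
have e : F = G by apply: functional_extensionality_dep => T; apply: funext => x.
by case: _ / e G_pull {FG} => G_pull; congr DMap; exact: Prop_irrelevance.
Qed.

Lemma any_map_vertex (P : operad) (phi : dmap X (nerve P)) (T : tree) (x : X T) v :
  any_map (phi T x) (AnyOp (vertex_op v)) = val_op phi (pull (op_map (tree_op_vertex v)) x).
Proof. by rewrite val_op_pull any_map_op_map. Qed.

(** By freeness it suffices to compare on edges and vertices, and a vertex is the value of a
    corolla-shaped dendrex, where [extension_val] applies. *)
Lemma extension_fac (P : operad) (phi : dmap X (nerve P)) :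
  dcomp (nerve_map (extension phi)) q = phi.
Proof.
apply: dmap_eq => T x; apply: omega_any_map_eq => [y|v].
  by rewrite /= !cmap_val col_val_quotient.
by rewrite [RHS]any_map_vertex -extension_val -any_map_vertex.
Qed.

(** Holds because [q] is surjective on colours and on operations. *)
Lemma quotient_epi (P : operad) (F G : operad_map HoX P) :
  dcomp (nerve_map F) q = dcomp (nerve_map G) q -> F = G.
Proof.
move=> FG; have FGx T (x : X T) : operad_comp F (q T x) = operad_comp G (q T x).
  exact: (congr1 (fun K : dmap X (nerve P) => K T x) FG).
have cFG : cmap F = cmap G.
  apply: funext => x; rewrite -[x]col_val_quotient.
  exact: (congr1 (fun K : operad_map (omega eta) P => cmap K tt) (FGx eta x)).
apply: operad_map_eq => // I c d p e.
have [f fp] := val_op_quotient_surj (AnyOp p).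
have : any_map F (AnyOp p) = any_map G (AnyOp p).
  by rewrite -fp; exact: (congr1 (fun K => any_map K (AnyOp (corolla_op I))) (FGx _ f)).
rewrite /any_map /= => pFG; apply: AnyOp_inj; rewrite -pFG.
by move: (cmap G) e; move=> h; case: _ /.
Qed.

End Universal.

(** * Comparison with the left adjoint of the nerve *)

Theorem proposition6p10 (X : dset) (X_kan : inner_kan X)
    (tau_d : nerve_left_adjoint)
    (H : operad_struct (@Ho X)) (q : dmap X (nerve (Operad H)))
    (q_quotient : is_Ho_quotient q) :
  operad_iso (adjoint tau_d q).
Proof.
(* The unit of the adjunction at [X]; its extension along [q] is the inverse. *)
pose unit_X := transpose (operad_id (tau_d X)).
exists (extension X_kan q_quotient unit_X); split.
  (* After transposing, this composite is the factorisation of the unit through [q]. *)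
  apply: (can_inj (@transposeK tau_d _ _)).
  by rewrite transpose_natr adjointK extension_fac.
(* The other composite is compared with the identity after precomposition with [q], where both give
   [q]. *)
apply: (quotient_epi q_quotient); set G := extension _ _ _.
have nerve_comp (P Q R : operad) (B : operad_map Q R) (A : operad_map P Q) :
    nerve_map (operad_comp B A) = dcomp (nerve_map B) (nerve_map A).
  by apply: dmap_eq => T x; exact: operad_compA.
have dcompA : dcomp (nerve_map (operad_comp (adjoint tau_d q) G)) q =
    dcomp (nerve_map (adjoint tau_d q)) (dcomp (nerve_map G) q).
  by apply: dmap_eq => T x; exact: operad_compA.
rewrite dcompA extension_fac -transpose_natr operad_comp1 adjointK.
apply: dmap_eq => T x; apply: operad_map_eq => // I c d f e.
by rewrite (Prop_irrelevance e erefl).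
Qed.
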